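(* Let $\phi(x)=\frac{ax+b}{cx+d}$ with $a,b,c,d\in\mathbb{Q}_2$, $ad-bc\ne0$, let $\Delta=(d-a)^2+4bc$ with $\sqrt{\Delta}\notin\mathbb{Q}_2$, and suppose that $\lambda=\frac{a+d+\sqrt{\Delta}}{a+d-\sqrt{\Delta}}$ is not a root of unity and that $\mathbb{Q}_2(\sqrt{\Delta})=\mathbb{Q}_2(\sqrt{-3})$. Let $r_0=|\sqrt{\Delta}/c|_2$, let $\eta\in\mathbb{Q}_2$ with $|\eta|_2=r_0$, and set $$h(x)=\eta x+\frac{a-d-2^{v_2(\sqrt{\Delta})}}{2c}.$$ If $(B,\phi)$ is a minimal subsystem of $(\mathbb{P}^1(\mathbb{Q}_2),\phi)$, then the unique invariant (Borel probability) measure $\hat\sigma$ of the system $(B,\phi)$ is given, for each measurable subset $A\subset B$, by $$\hat\sigma(A)=\frac{\hat\mu(h^{-1}(A))}{\hat\mu(h^{-1}(B))}.$$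
   Context: $\mathbb{P}^1(\mathbb{Q}_2)=\mathbb{Q}_2\cup\{\infty\}$ with its usual compact topology; $|\cdot|_2$ and $v_2=-\log_2|\cdot|_2$ are extended to $\mathbb{Q}_2(\sqrt\Delta)$; $h$ is extended by $h(\infty)=\infty$. (The hypothesis $\sqrt\Delta\notin\mathbb{Q}_2$ forces $c\ne 0$.) A subsystem is a pair $(B,\phi)$ with $B$ nonempty compact and $\phi(B)\subset B$; it is minimal if $B=\overline{\{\phi^n(x):n\ge0\}}$ for every $x\in B$. Let $\mu_0$ be the Haar probability measure on $\mathbb{Z}_2$ and $\xi:\mathbb{P}^1(\mathbb{Q}_2)\to\mathbb{P}^1(\mathbb{Q}_2)$, $\xi(z)=1/z$. For a Borel set $S\subset\mathbb{P}^1(\mathbb{Q}_2)$ put $S_1=\mathbb{Z}_2\cap S$, $S_2=(\mathbb{P}^1(\mathbb{Q}_2)\setminus\mathbb{Z}_2)\cap S$ (so $\xi^{-1}(S_2)\subset 2\mathbb{Z}_2$), and define the probability measure $$\hat\mu(S):=\frac{2}{3}\bigl(\mu_0(S_1)+\mu_0(\xi^{-1}(S_2))\bigr).$$ *)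

(* Defs.v *)
From HB Require Import structures.
From mathcomp Require Import all_boot all_order all_algebra all_field.
From mathcomp Require Import all_classical all_reals all_analysis.
From mathcomp Require Import lra.

Set Implicit Arguments.
Unset Strict Implicit.
Unset Printing Implicit Defensive.

Import Order.TTheory GRing.Theory Num.Theory.

Local Open Scope classical_set_scope.
Local Open Scope ring_scope.

Definition v2Q (q : rat) : int :=
  (logn 2 `|numq q|)%:Z - (logn 2 `|denq q|)%:Z.

Definition abs2Q (q : rat) : rat := if q == 0 then 0 else 2 ^ (- v2Q q).

Lemma v2Q_frac (n d : int) : n != 0 -> d != 0 ->
  v2Q (n%:~R / d%:~R) = (logn 2 `|n|)%:Z - (logn 2 `|d|)%:Z.
Proof.
move=> n0 d0; set q := _ / _.
have q0 : q != 0 by rewrite mulf_neq0 ?invr_eq0 ?intr_eq0.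
have E : numq q * d = n * denq q.
  apply/eqP; rewrite -(eqr_int rat) !intrM.
  have := denq_neq0 q; rewrite -(intr_eq0 rat) => dq0.
  have d0' : d%:~R != 0 :> rat by rewrite intr_eq0.
  have : (numq q)%:~R / (denq q)%:~R = n%:~R / d%:~R :> rat
    by rewrite divq_num_den.
  by move/eqP; rewrite eqr_div.
have := congr1 (fun z => logn 2 `|z|) E.
rewrite !abszM !lognM ?absz_gt0 ?numq_eq0 ?denq_neq0// => H.
rewrite /v2Q; apply/eqP; rewrite subr_eq addrAC eq_sym subr_eq -!PoszD.
by rewrite H.
Qed.

Lemma v2QM x y : x != 0 -> y != 0 -> v2Q (x * y) = v2Q x + v2Q y.
Proof.
move=> x0 y0; rewrite -{1}(divq_num_den x) -{1}(divq_num_den y) mulf_div.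
rewrite -!intrM v2Q_frac ?mulf_neq0 ?numq_eq0 ?denq_neq0//.
rewrite !abszM !lognM ?absz_gt0 ?numq_eq0 ?denq_neq0//.
by rewrite /v2Q !PoszD opprD addrACA.
Qed.

Lemma abs2Q0 : abs2Q 0 = 0. Proof. by rewrite /abs2Q eqxx. Qed.

Lemma abs2Q1 : abs2Q 1 = 1. Proof. by []. Qed.

Lemma abs2QM x y : abs2Q (x * y) = abs2Q x * abs2Q y.
Proof.
rewrite /abs2Q mulf_eq0; case: eqVneq => [|x0] /=; first by rewrite mul0r.
case: eqVneq => [|y0] /=; first by rewrite mulr0.
by rewrite v2QM// opprD expfzDr.
Qed.

Lemma abs2Q_gt0 x : (0 < abs2Q x) = (x != 0).
Proof. by rewrite /abs2Q; case: eqVneq => //= x0; rewrite exprz_gt0. Qed.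

Lemma abs2Q_eq0 x : (abs2Q x == 0) = (x == 0).
Proof.
apply/idP/idP => [|/eqP->]; last by rewrite abs2Q0.
by apply: contraTT; rewrite -abs2Q_gt0 => /lt0r_neq0.
Qed.

Lemma abs2Q_ge0 x : 0 <= abs2Q x.
Proof.
by case: (eqVneq x 0) => [->|]; [rewrite abs2Q0|rewrite -abs2Q_gt0 => /ltW].
Qed.

Lemma abs2QN x : abs2Q (- x) = abs2Q x.
Proof. by rewrite /abs2Q oppr_eq0 /v2Q numqN denqN abszN. Qed.

Lemma abs2QV x : abs2Q x^-1 = (abs2Q x)^-1.
Proof.
have [->|x0] := eqVneq x 0; first by rewrite !(invr0, abs2Q0).
have a0 : abs2Q x != 0 by rewrite abs2Q_eq0.
by apply: (mulfI a0); rewrite -abs2QM !mulfV// abs2Q1.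
Qed.

Lemma logn2_addz (m n : int) : m != 0 -> n != 0 -> m + n != 0 ->
  (minn (logn 2 `|m|) (logn 2 `|n|) <= logn 2 (absz (m + n)%R))%N.
Proof.
move=> m0 n0 mn0; rewrite -pfactor_dvdn ?absz_gt0//.
set k := minn _ _.
suff : ((2 ^ k)%N%:Z %| m + n)%Z by rewrite dvdzE.
by apply: rpredD; rewrite dvdzE /= pfactor_dvdn ?absz_gt0// ?geq_minl ?geq_minr.
Qed.

Lemma abs2Q_ultra x y : abs2Q (x + y) <= Num.max (abs2Q x) (abs2Q y).
Proof.
have [->|x0] := eqVneq x 0; first by rewrite add0r le_max lexx orbT.
have [->|y0] := eqVneq y 0; first by rewrite addr0 le_max lexx.
have [->|s0] := eqVneq (x + y) 0; first by rewrite abs2Q0 le_max abs2Q_ge0.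
pose d := denq x * denq y.
pose n := numq x * denq y; pose m := numq y * denq x.
have d0 : d != 0 by rewrite mulf_neq0 ?denq_neq0.
have dx : (denq x)%:~R != 0 :> rat by rewrite intr_eq0 denq_neq0.
have dy : (denq y)%:~R != 0 :> rat by rewrite intr_eq0 denq_neq0.
have n0 : n != 0 by rewrite mulf_neq0 ?numq_eq0 ?denq_neq0.
have m0 : m != 0 by rewrite mulf_neq0 ?numq_eq0 ?denq_neq0.
have Ex : x = n%:~R / d%:~R.
  by rewrite /n /d !intrM -mulf_div divff// mulr1 divq_num_den.
have Ey : y = m%:~R / d%:~R.
  rewrite /m /d !intrM [(denq x)%:~R * _]mulrC -mulf_div divff// mulr1.
  by rewrite divq_num_den.
have Es : x + y = (n + m)%:~R / d%:~R by rewrite {1}Ex {1}Ey -mulrDl -intrD.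
have s0' : n + m != 0.
  by apply: contraNneq s0; rewrite Es => ->; rewrite mul0r.
rewrite /abs2Q (negbTE x0) (negbTE y0) (negbTE s0).
rewrite Es (congr1 v2Q Ex) (congr1 v2Q Ey) !v2Q_frac// le_max !ler_eXz2l// !lerN2 !lerD2r !lez_nat.
have := logn2_addz n0 m0 s0'.
by case: (leqP (logn 2 `|n|) (logn 2 `|m|)) => h /= ->; rewrite ?orbT.
Qed.

Lemma abs2Q_triangle x y : abs2Q (x + y) <= abs2Q x + abs2Q y.
Proof.
apply: (le_trans (abs2Q_ultra _ _)).
by rewrite ge_max lerDl lerDr !abs2Q_ge0.
Qed.

Lemma abs2Q_dist x y : `|abs2Q x - abs2Q y| <= abs2Q (x - y).
Proof.
rewrite ler_norml; apply/andP; split.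
  rewrite lerNl opprB lerBlDr -(abs2QN (x - y)) opprB.
  by rewrite (le_trans _ (abs2Q_triangle _ _))// subrK.
by rewrite lerBlDr (le_trans _ (abs2Q_triangle _ _))// subrK.
Qed.

Lemma abs2Q_eq x y : abs2Q (x - y) < abs2Q y -> abs2Q x = abs2Q y.
Proof.
move=> h; apply/eqP; rewrite eq_le; apply/andP; split.
  have := abs2Q_ultra (x - y) y; rewrite subrK => /le_trans; apply.
  by rewrite ge_max lexx (ltW h).
have := abs2Q_ultra (y - x) x; rewrite subrK le_max => /orP[|//].
by rewrite -(abs2QN (y - x)) opprB leNgt h.
Qed.

(* Q_2 is the completion of (rat, abs2Q): the ring of Cauchy sequences modulo *)
(* the ideal of null sequences.                                               *)
Definition cauchy2 (u : nat -> rat) : Prop := forall e : rat, 0 < e ->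
  exists N, forall m n, (N <= m)%N -> (N <= n)%N -> abs2Q (u m - u n) < e.

Definition null2 (u : nat -> rat) : Prop := forall e : rat, 0 < e ->
  exists N, forall n, (N <= n)%N -> abs2Q (u n) < e.

Lemma cauchy2_bounded u : cauchy2 u ->
  exists2 C, 0 < C & exists N, forall n, (N <= n)%N -> abs2Q (u n) <= C.
Proof.
move=> /(_ 1 ltr01)[N hN]; exists (1 + abs2Q (u N)).
  by rewrite ltr_pwDl// abs2Q_ge0.
exists N => n Nn; have := abs2Q_triangle (u n - u N) (u N).
by rewrite subrK => /le_trans; apply; rewrite lerD2r ltW// hN.
Qed.

Definition cauchy2_pred : {pred nat -> rat} := fun u => `[< cauchy2 u >].

Lemma cauchy2_subring : subring_closed cauchy2_pred.
Proof.
split.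
- by apply/asboolP => e e0; exists 0%N => m n _ _; rewrite subrr abs2Q0.
- move=> u v /asboolP cu /asboolP cv; apply/asboolP => e e0.
  have e2 : 0 < e / 2 by rewrite divr_gt0.
  have [N hN] := cu _ e2; have [M hM] := cv _ e2.
  exists (maxn N M) => m n; rewrite !geq_max => /andP[Nm Mm] /andP[Nn Mn].
  have -> : (u - v) m - (u - v) n = (u m - u n) + - (v m - v n).
    by rewrite [(u - v) m]/= [(u - v) n]/= !opprB addrACA [RHS]addrACA [- u n + _]addrC.
  apply: (le_lt_trans (abs2Q_triangle _ _)); rewrite abs2QN (splitr e).
  by rewrite ltrD ?hN ?hM.
- move=> u v /asboolP cu /asboolP cv; apply/asboolP => e e0.
  have [C C0 [N1 hC]] := cauchy2_bounded cu.
  have [D D0 [N2 hD]] := cauchy2_bounded cv.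
  have [N hN] := cu (e / 2 / D) (divr_gt0 (divr_gt0 e0 (ltr0Sn _ 1)) D0).
  have [M hM] := cv (e / 2 / C) (divr_gt0 (divr_gt0 e0 (ltr0Sn _ 1)) C0).
  exists (maxn (maxn N1 N2) (maxn N M)) => m n.
  rewrite !geq_max => /andP[/andP[N1m N2m] /andP[Nm Mm]].
  move=> /andP[/andP[N1n N2n] /andP[Nn Mn]].
  have -> : (u * v) m - (u * v) n = u m * (v m - v n) + (u m - u n) * v n.
    by rewrite mulrBr mulrBl addrA subrK.
  apply: (le_lt_trans (abs2Q_triangle _ _)); rewrite !abs2QM (splitr e) ltrD//.
    apply: (@le_lt_trans _ _ (C * abs2Q (v m - v n))).
      by rewrite ler_wpM2r ?abs2Q_ge0 ?hC.
    by rewrite mulrC -ltr_pdivlMr// hM.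
  apply: (@le_lt_trans _ _ (abs2Q (u m - u n) * D)).
    by rewrite ler_wpM2l ?abs2Q_ge0 ?hD.
  by rewrite -ltr_pdivlMr// hN.
Qed.

HB.instance Definition _ :=
  GRing.isSubringClosed.Build (nat -> rat) cauchy2_pred cauchy2_subring.

Record cauchy2_seq := Cauchy2Seq {
  cauchy2_fun :> nat -> rat ;
  cauchy2_funP : cauchy2_fun \in cauchy2_pred }.

HB.instance Definition _ := [isSub for cauchy2_fun].
HB.instance Definition _ := [Choice of cauchy2_seq by <:].
HB.instance Definition _ := [SubChoice_isSubComNzRing of cauchy2_seq by <:].

Lemma cauchy2_seqP (u : cauchy2_seq) : cauchy2 u.
Proof. exact/asboolP/cauchy2_funP. Qed.

Definition null2_pred : {pred cauchy2_seq} := fun u => `[< null2 u >].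

Lemma null2_idealr : idealr_closed null2_pred.
Proof.
split.
- by apply/asboolP => e e0; exists 0%N => n _; rewrite /= abs2Q0.
- apply/negP => /asboolP /(_ 1 ltr01)[N /(_ N (leqnn _))] /=.
  by rewrite abs2Q1 ltxx.
- move=> a u v /asboolP nu /asboolP nv; apply/asboolP => e e0.
  have [C C0 [N1 hC]] := cauchy2_bounded (cauchy2_seqP a).
  have e2 : 0 < e / 2 by rewrite divr_gt0.
  have [N hN] := nu (e / 2 / C) (divr_gt0 e2 C0); have [M hM] := nv _ e2.
  exists (maxn N1 (maxn N M)) => n; rewrite !geq_max => /and3P[N1n Nn Mn].
  apply: (le_lt_trans (abs2Q_triangle _ _)); rewrite (splitr e) ltrD ?hM//.
  rewrite abs2QM; apply: (@le_lt_trans _ _ (C * abs2Q (u n))).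
    by rewrite ler_wpM2r ?abs2Q_ge0 ?hC.
  by rewrite mulrC -ltr_pdivlMr// hN.
Qed.

HB.instance Definition _ :=
  isIdealr.Build cauchy2_seq null2_pred null2_idealr.

Definition Q2 : Type := {ideal_quot null2_pred}.

HB.instance Definition _ := GRing.ComNzRing.on Q2.

Definition Q2_pi (u : cauchy2_seq) : Q2 := (\pi_{ideal_quot null2_pred} u)%qT.
Definition Q2_repr (x : Q2) : cauchy2_seq :=
  repr (x : {ideal_quot null2_pred}).

Lemma Q2_reprK (x : Q2) : Q2_pi (Q2_repr x) = x.
Proof. exact: reprK. Qed.

Lemma Q2_piP (u v : cauchy2_seq) : Q2_pi u = Q2_pi v <-> null2 (u - v).
Proof.
split=> [/eqP|nuv]; first by rewrite -Quotient.idealrBE => /asboolP.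
by apply/eqP; rewrite -Quotient.idealrBE; apply/asboolP.
Qed.

Lemma Q2_pi0 : Q2_pi 0 = 0. Proof. exact: raddf0. Qed.

Lemma Q2_pi1 : Q2_pi 1 = 1. Proof. exact: rmorph1. Qed.

Lemma Q2_piN u : Q2_pi (- u) = - Q2_pi u. Proof. exact: raddfN. Qed.

Lemma Q2_piD u v : Q2_pi (u + v) = Q2_pi u + Q2_pi v.
Proof. exact: raddfD. Qed.

Lemma Q2_piM u v : Q2_pi (u * v) = Q2_pi u * Q2_pi v.
Proof. exact: rmorphM. Qed.

Lemma Q2_pi_eq0 u : Q2_pi u = 0 <-> null2 u.
Proof. by rewrite -Q2_pi0 Q2_piP subr0. Qed.

Lemma cauchy2_abs (u : nat -> rat) : cauchy2 u -> ~ null2 u ->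
  exists2 r, 0 < r & exists N, forall n, (N <= n)%N -> abs2Q (u n) = r.
Proof.
move=> cu /existsNP[e /not_implyP[e0 /forallNP nu]].
have [N hN] := cu _ e0.
have /existsNP[k /not_implyP[Nk /negP]] := nu N; rewrite -leNgt => ek.
exists (abs2Q (u k)); first exact: lt_le_trans ek.
by exists N => n Nn; apply/abs2Q_eq/(lt_le_trans (hN _ _ Nn Nk)).
Qed.

Lemma Q2_inv_ex (x : Q2) : x != 0 -> exists y, y * x = 1.
Proof.
rewrite -[x]Q2_reprK; set u := Q2_repr x => /eqP x0.
have nu : ~ null2 u by move=> /Q2_pi_eq0.
have [r r0 [N hN]] := cauchy2_abs (cauchy2_seqP u) nu.
have cv : (fun n => (u n)^-1) \in cauchy2_pred.
  apply/asboolP => e e0.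
  have [M hM] := cauchy2_seqP u (mulr_gt0 e0 (mulr_gt0 r0 r0)).
  exists (maxn N M) => m n; rewrite !geq_max => /andP[Nm Mm] /andP[Nn Mn].
  have um : u m != 0 by rewrite -abs2Q_gt0 hN.
  have un : u n != 0 by rewrite -abs2Q_gt0 hN.
  have -> : (u m)^-1 - (u n)^-1 = (u n - u m) * ((u m)^-1 * (u n)^-1).
    by rewrite mulrBl [u n * _]mulrC mulfVK// mulrA mulfV// mul1r.
  rewrite !abs2QM !abs2QV !hN// -invfM ltr_pdivrMr ?mulr_gt0//.
  exact: hM.
exists (Q2_pi (Cauchy2Seq cv)); rewrite -Q2_piM -Q2_pi1; apply/Q2_piP => e e0.
exists N => n Nn; rewrite -[X in abs2Q X]/((u n)^-1 * u n - 1).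
rewrite mulVf ?subrr ?abs2Q0//.
by rewrite -abs2Q_gt0 hN.
Qed.

Definition Q2_inv (x : Q2) : Q2 :=
  if pselect (exists y, y * x = 1) is left e then sval (cid e) else 0.

Lemma Q2_mulVf (x : Q2) : x != 0 -> Q2_inv x * x = 1.
Proof.
by move=> /Q2_inv_ex x1; rewrite /Q2_inv; case: pselect => // e; case: cid.
Qed.

Lemma Q2_inv0 : Q2_inv 0 = 0.
Proof.
rewrite /Q2_inv; case: pselect => // e; exfalso; case: e => y /esym/eqP.
by rewrite mulr0 oner_eq0.
Qed.

HB.instance Definition _ := GRing.ComNzRing_isField.Build Q2 Q2_mulVf Q2_inv0.

(* The limit exists, the absolute values of a Cauchy sequence being either    *)
(* eventually constant or convergent to 0: see abs2P.                         *)
Definition abs2_lim (u : nat -> rat) (r : rat) : Prop := forall e : rat, 0 < e ->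
  exists N, forall n, (N <= n)%N -> `|abs2Q (u n) - r| < e.

Definition abs2 (x : Q2) : rat := xget 0 [set r | abs2_lim (Q2_repr x) r].

Lemma abs2_lim_uniq u r s : abs2_lim u r -> abs2_lim u s -> r = s.
Proof.
move=> ur us; apply/eqP; rewrite -subr_eq0 -normr_eq0; apply/negPn/negP.
rewrite -normr_gt0 normr_id => e0.
have e2 : 0 < `|r - s| / 2 by rewrite divr_gt0.
have [N hN] := ur _ e2; have [M hM] := us _ e2.
have := ltrD (hN _ (leq_maxl N M)) (hM _ (leq_maxr N M)); rewrite -splitr.
rewrite distrC => /lt_le_trans/(_ (ler_distD (abs2Q (u (maxn N M))) _ _)).
by rewrite ltxx.
Qed.

Lemma abs2_lim_null u v r : null2 (u - v) -> abs2_lim u r -> abs2_lim v r.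
Proof.
move=> nuv ur e e0; have e2 : 0 < e / 2 by rewrite divr_gt0.
have [N hN] := nuv _ e2; have [M hM] := ur _ e2.
exists (maxn N M) => n; rewrite geq_max => /andP[Nn Mn].
apply: (le_lt_trans (ler_distD (abs2Q (u n)) _ _)).
rewrite (splitr e) ltrD ?hM// distrC (le_lt_trans (abs2Q_dist _ _))//.
exact: hN.
Qed.

Lemma abs2_lim_ex u : cauchy2 u -> exists r, abs2_lim u r.
Proof.
move=> cu; have [nu|nu] := pselect (null2 u).
  exists 0 => e /nu[N hN]; exists N => n Nn.
  by rewrite subr0 ger0_norm ?abs2Q_ge0 ?hN.
have [r _ [N hN]] := cauchy2_abs cu nu.
by exists r => e e0; exists N => n Nn; rewrite hN// subrr normr0.
Qed.

Lemma abs2P (x : Q2) : abs2_lim (Q2_repr x) (abs2 x).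
Proof.
have [r ur] := abs2_lim_ex (cauchy2_seqP (Q2_repr x)).
by apply: xgetPex; exists r.
Qed.

Lemma abs2_pi (u : cauchy2_seq) : abs2_lim u (abs2 (Q2_pi u)).
Proof.
by apply: abs2_lim_null (@abs2P _); apply/Q2_piP; rewrite Q2_reprK.
Qed.

Lemma abs2_piE (u : cauchy2_seq) r : abs2_lim u r -> abs2 (Q2_pi u) = r.
Proof. exact: abs2_lim_uniq (abs2_pi u). Qed.

Lemma abs20 : abs2 0 = 0.
Proof.
rewrite -Q2_pi0; apply: abs2_piE => e e0; exists 0%N => n _ /=.
by rewrite abs2Q0 subrr normr0.
Qed.

Lemma abs2_eq0 x : abs2 x = 0 -> x = 0.
Proof.
rewrite -[x]Q2_reprK => x0; apply/Q2_pi_eq0 => e e0.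
have [N hN] := abs2_pi (Q2_repr x) e0; exists N => n /hN.
by rewrite x0 subr0 ger0_norm// abs2Q_ge0.
Qed.

Lemma abs2N x : abs2 (- x) = abs2 x.
Proof.
rewrite -[x]Q2_reprK -Q2_piN; apply: abs2_piE => e e0.
have [N hN] := abs2_pi (Q2_repr x) e0; exists N => n /hN /=.
by rewrite abs2QN.
Qed.

Lemma abs2_triangle x y : abs2 (x + y) <= abs2 x + abs2 y.
Proof.
rewrite -[x]Q2_reprK -[y]Q2_reprK -Q2_piD.
set u := Q2_repr x; set v := Q2_repr y.
rewrite leNgt -subr_gt0; apply/negP => e0; set e := _ - _ in e0.
have e3 : 0 < e / 3%:R by rewrite divr_gt0.
have [N1 h1] := abs2_pi u e3; have [N2 h2] := abs2_pi v e3.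
have [N3 h3] := abs2_pi (u + v) e3.
pose n := maxn N1 (maxn N2 N3).
have := h1 n (leq_maxl _ _).
have := h2 n (leq_trans (leq_maxl _ _) (leq_maxr _ _)).
have := h3 n (leq_trans (leq_maxr _ _) (leq_maxr _ _)).
have := abs2Q_triangle (u n) (v n).
rewrite -[(u + v) n]/(u n + v n) !ltr_norml.
have : e = abs2 (Q2_pi (u + v)) - (abs2 (Q2_pi u) + abs2 (Q2_pi v)) by [].
by lra.
Qed.

Definition dist2 (x y : Q2) : rat := abs2 (x - y).

Lemma dist2xx x : dist2 x x = 0.
Proof. by rewrite /dist2 subrr abs20. Qed.

Lemma dist2_positivity x y : dist2 x y = 0 -> x = y.
Proof. by move=> /abs2_eq0/subr0_eq. Qed.

Lemma dist2_sym x y : dist2 x y = dist2 y x.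
Proof. by rewrite /dist2 -abs2N opprB. Qed.

Lemma dist2_triangle y x z : dist2 x z <= dist2 x y + dist2 y z.
Proof. by rewrite /dist2 -(subrKA y) abs2_triangle. Qed.

HB.instance Definition _ := isMetric.Build rat Q2
  dist2xx dist2_positivity dist2_sym dist2_triangle.
HB.instance Definition _ := isPointed.Build Q2 0.

Definition Z2 : set Q2 := [set x | abs2 x <= 1].

(* P^1(Q_2): `Some x` is the point x of Q_2 and `None` is infinity; the       *)
(* topology is that of the one-point compactification.                        *)
Definition P1 : Type := one_point_compactification Q2.

Definition borel (T : ptopologicalType) : Type := g_sigma_algebraType (@open T).

Definition mobius (a b c d : Q2) (x : P1) : P1 :=
  match x with
  | Some x => if c * x + d == 0 then None else Some ((a * x + b) / (c * x + d))
  | None => if c == 0 then None else Some (a / c)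
  end.

Definition affine (eta beta : Q2) (x : P1) : P1 :=
  if x is Some x then Some (eta * x + beta) else None.

Definition xi (x : P1) : P1 :=
  if x is Some z then if z == 0 then None else Some z^-1 else Some 0.

Definition subsystem (f : P1 -> P1) (B : set P1) : Prop :=
  [/\ B !=set0, compact B & f @` B `<=` B].

Definition minimal_subsystem (f : P1 -> P1) (B : set P1) : Prop :=
  subsystem f B /\
  forall x, B x -> B = closure [set iter n f x | n in [set: nat]].

(* A Borel probability measure on a compact set is encoded as a Borel         *)
(* probability measure of the ambient space giving mass 1 to that set.        *)
Definition haar_probability_Z2 (R : realType)
    (mu : probability (borel Q2) R) : Prop :=
  mu Z2 = 1%E /\
  forall (a : Q2) (A : set (borel Q2)), Z2 a -> measurable A -> A `<=` Z2 ->
    mu [set a + x | x in A] = mu A.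

Definition invariant_probability (R : realType) (f : P1 -> P1) (B : set P1)
    (sigma : probability (borel P1) R) : Prop :=
  sigma B = 1%E /\
  forall A : set (borel P1), measurable A -> A `<=` B ->
    sigma (B `&` f @^-1` A) = sigma A.

Definition mu_hat (R : realType) (mu0 : probability (borel Q2) R)
    (S : set P1) : \bar R :=
  let S1 : set Q2 := Z2 `&` Some @^-1` S in
  let S2 : set P1 := ~` (Some @` Z2) `&` S in
  ((2 / 3)%:E * (mu0 S1 + mu0 [set z | S2 (xi (Some z))]))%E.

(* Such an extension exists and is unique, as Q_2 is complete and L / Q_2 is  *)
(* finite.                                                                    *)
Definition extends_abs2 (R : realType) (L : fieldExtType Q2)
    (absL : L -> R) : Prop :=
  [/\ forall x, 0 <= absL x,
      forall x, absL x = 0 -> x = 0,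
      forall x y, absL (x * y) = absL x * absL y,
      forall x y, absL (x + y) <= absL x + absL y &
      forall x : Q2, absL x%:A = ratr (abs2 x)].

Definition v2 (R : realType) (L : fieldExtType Q2) (absL : L -> R) (x : L) : R :=
  - (ln (absL x) / ln 2).

(* Main.v *)
Require Import Defs.
From HB Require Import structures.
From mathcomp Require Import all_boot all_order all_algebra all_field.
From mathcomp Require Import all_classical all_reals all_analysis.
From mathcomp Require Import ring lra zify.

Set Implicit Arguments.
Unset Strict Implicit.
Unset Printing Implicit Defensive.

Import Order.TTheory GRing.Theory Num.Theory.

Local Open Scope classical_set_scope.
Local Open Scope ring_scope.

(* Conjugating by h turns phi into x + y N for a unimodular pair (x, y) and   *)
(* N = [[1, n1], [n2, 0]] with n1, n2 units, so that Q_2[N] is the unramified *)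
(* quadratic extension. Such a matrix is an isometry of P^1(Q_2) for the      *)
(* chordal ultrametric rho and moves every point by exactly |y|. As lambda is *)
(* not a root of unity, the sixth power has 0 < |y| <= 1/4, and squaring then *)
(* halves |y|; hence every orbit is dense in a ball of a fixed radius, and    *)
(* minimal sets have positive mass. Both the measure mu_hat o h^-1 and an     *)
(* invariant measure restricted to a minimal set give the same mass to all    *)
(* balls of a given radius that meet that set. This yields the invariance of  *)
(* the former and, the balls generating the Borel sets, uniqueness.           *)

(** Let M be the matrix of phi and T the power of 2 with |T| = |sqrt Delta|. The field hypothesis
    gives Delta = -3 w^2 with |w| = |T| ([adjoin_sqrt_mul]), and h is the affine change of variable
    for which h^-1 M h = k (x + y N), where N^2 = N + n1 n2 and n1 n2 is a unit ([mobius_conj],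
    [conj_norm], [unit_square]). The norm x^2 + x y - n1 n2 y^2 is anisotropic modulo 2, so x + y N
    lies in GL_2(Z_2) for (x, y) primitive and preserves rho; a similar form shows that it moves
    every point by |y| ([rho_mobN_displacement]).

    Density: modulo 2 the ring Z_2[N] is F_4, so a cube has y even and a sixth power has y divisible
    by 4 ([psix_level]), while lambda^6 != 1 keeps that y nonzero ([psix_neq0]). From there each
    squaring halves |y| exactly, so iterates of phi have every displacement 2^-j with j >= m; they
    correct an orbit one binary digit at a time towards any target within 2^-m ([mobN_orbit_dense]).

    Measure: the cells, which are the h-images of rho-balls, have a mu_hat o h^-1 mass depending on
    the radius only ([mu_hat_cell]). They form a pi-system generating the Borel sets, so phi
    preserves this measure ([isometry_preserves]). A minimal B contains a cell, hence has positive
    mass, and the normalized restriction is invariant ([minimal_subsystem_measure]). Conversely, any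
    invariant measure on B gives equal mass to all cells of one radius that meet B and none to the
    others, so total mass 1 determines it ([invariant_probability_unique]). *)

Lemma abs2Q_lim_eventually (u : nat -> rat) r :
  (exists N, forall n, (N <= n)%N -> abs2Q (u n) = r) -> abs2_lim u r.
Proof.
by move=> [N hN] e e0; exists N => n /hN ->; rewrite subrr normr0.
Qed.

(** Away from 0 the absolute value is locally constant, so properties of [abs2Q] pass to [abs2] by
    evaluation at one large index. *)
Lemma abs2Q_eventually (u : cauchy2_seq) : Q2_pi u != 0 ->
  exists N, forall n, (N <= n)%N -> abs2Q (u n) = abs2 (Q2_pi u).
Proof.
move=> u0; have nu : ~ null2 u by move=> /Q2_pi_eq0/eqP; apply/negP.
have [r r0 [N hN]] := cauchy2_abs (cauchy2_seqP u) nu.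
exists N => n Nn; rewrite (@abs2_piE u r) ?hN//.
by apply: abs2Q_lim_eventually; exists N.
Qed.

Lemma abs2_ex (x : Q2) : x != 0 -> exists2 q : rat, q != 0 & abs2 x = abs2Q q.
Proof.
rewrite -[x]Q2_reprK => x0; have [N hN] := abs2Q_eventually x0.
exists (Q2_repr x N); last by rewrite -(hN N).
apply: contraNneq x0 => q0; apply/eqP/abs2_eq0.
by rewrite -(hN N)// q0 abs2Q0.
Qed.

Lemma abs2_eq0E (x : Q2) : (abs2 x == 0) = (x == 0).
Proof.
by apply/eqP/eqP => [/abs2_eq0//|->]; exact: abs20.
Qed.

Lemma abs2_ge0 (x : Q2) : 0 <= abs2 x.
Proof.
have [->|/abs2_ex[q _ ->]] := eqVneq x 0; first by rewrite abs20.
exact: abs2Q_ge0.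
Qed.

Lemma abs2_gt0 (x : Q2) : (0 < abs2 x) = (x != 0).
Proof. by rewrite lt_neqAle abs2_ge0 andbT eq_sym abs2_eq0E. Qed.

Lemma abs2M (x y : Q2) : abs2 (x * y) = abs2 x * abs2 y.
Proof.
have [->|x0] := eqVneq x 0; first by rewrite mul0r abs20 mul0r.
have [->|y0] := eqVneq y 0; first by rewrite mulr0 abs20 mulr0.
move: x0 y0; rewrite -[x]Q2_reprK -[y]Q2_reprK => x0 y0.
have [N hN] := abs2Q_eventually x0; have [M hM] := abs2Q_eventually y0.
rewrite -Q2_piM; apply/abs2_piE/abs2Q_lim_eventually.
exists (maxn N M) => n; rewrite geq_max => /andP[Nn Mn].
by rewrite -(hN n)// -(hM n)// -abs2QM.
Qed.

Lemma abs2_ultra (x y : Q2) : abs2 (x + y) <= Num.max (abs2 x) (abs2 y).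
Proof.
have [->|x0] := eqVneq x 0; first by rewrite add0r le_max lexx orbT.
have [->|y0] := eqVneq y 0; first by rewrite addr0 le_max lexx.
have [->|] := eqVneq (x + y) 0; first by rewrite abs20 le_max abs2_ge0.
move: x0 y0; rewrite -[x]Q2_reprK -[y]Q2_reprK -Q2_piD => x0 y0 s0.
have [N hN] := abs2Q_eventually x0; have [M hM] := abs2Q_eventually y0.
have [P hP] := abs2Q_eventually s0.
pose n := maxn N (maxn M P).
rewrite -(hP n) ?leq_max ?leqnn ?orbT// -(hN n) ?leq_max ?leqnn ?orbT//.
rewrite -(hM n) ?leq_max ?leqnn ?orbT//.
exact: abs2Q_ultra.
Qed.

Lemma abs21 : abs2 1 = 1.
Proof.
have h : abs2 1 * abs2 1 = abs2 1 * 1 by rewrite -abs2M !mulr1.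
by apply: mulfI h; rewrite abs2_eq0E oner_eq0.
Qed.

Lemma abs2V (x : Q2) : abs2 x^-1 = (abs2 x)^-1.
Proof.
have [->|x0] := eqVneq x 0; first by rewrite invr0 abs20 invr0.
by apply: (@mulfI _ (abs2 x)); rewrite ?abs2_eq0E// -abs2M !divff ?abs21 ?abs2_eq0E.
Qed.

Lemma abs2X (x : Q2) n : abs2 (x ^+ n) = abs2 x ^+ n.
Proof. by elim: n => [|n IH]; rewrite ?abs21// !exprS abs2M IH. Qed.

Lemma abs2_distC (x y : Q2) : abs2 (x - y) = abs2 (y - x).
Proof. exact: dist2_sym. Qed.

Lemma abs2_le_add (r : rat) (x y : Q2) :
  abs2 x <= r -> abs2 y <= r -> abs2 (x + y) <= r.
Proof.
by move=> hx hy; apply: le_trans (abs2_ultra _ _) _; rewrite ge_max hx.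
Qed.

Lemma abs2_lt_add (r : rat) (x y : Q2) :
  abs2 x < r -> abs2 y < r -> abs2 (x + y) < r.
Proof.
by move=> hx hy; apply: le_lt_trans (abs2_ultra _ _) _; rewrite gt_max hx.
Qed.

Lemma abs2_lt_sub (r : rat) (x y : Q2) :
  abs2 x < r -> abs2 y < r -> abs2 (x - y) < r.
Proof. by move=> hx hy; apply: abs2_lt_add; rewrite ?abs2N. Qed.

Lemma abs2_addl (x y : Q2) : abs2 y < abs2 x -> abs2 (x + y) = abs2 x.
Proof.
move=> yx; apply/le_anti/andP; split; first by rewrite abs2_le_add// ltW.
rewrite leNgt; apply/negP => h.
by have := abs2_lt_sub h yx; rewrite addrK ltxx.
Qed.

Definition const2 (q : rat) : cauchy2_seq.
Proof.
exists (fun=> q); apply/asboolP => e e0.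
by exists 0%N => m n _ _; rewrite subrr abs2Q0.
Defined.

Lemma natr_const2 n : n%:R = Q2_pi (const2 n%:R).
Proof.
elim: n => [|n IH].
  by apply/esym/Q2_pi_eq0 => e e0; exists 0%N => n _; rewrite /= abs2Q0.
rewrite -addn1 natrD IH -Q2_pi1 -Q2_piD; congr Q2_pi.
by apply: val_inj; apply/funext => k /=; rewrite natrD.
Qed.

Lemma abs2_nat n : abs2 n%:R = abs2Q n%:R.
Proof.
rewrite natr_const2; apply/abs2_piE/abs2Q_lim_eventually.
by exists 0%N.
Qed.

Lemma abs2_2 : abs2 2 = 2^-1.
Proof. by rewrite abs2_nat. Qed.

Lemma Q2_2neq0 : 2 != 0 :> Q2.
Proof. by rewrite -abs2_eq0E abs2_2. Qed.

Lemma abs2_exp2 (k : int) : abs2 (2 ^ k) = 2 ^ (- k).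
Proof.
by case: k => n; rewrite ?NegzE ?opprK -?exprnN -?exprnP ?abs2V abs2X abs2_2 ?exprVn ?invrK.
Qed.

Lemma abs2_val (x : Q2) : x != 0 -> exists k : int, abs2 x = abs2 (2 ^ k).
Proof.
move=> /abs2_ex[q q0 ->]; exists (v2Q q).
by rewrite abs2_exp2 /abs2Q (negbTE q0).
Qed.

(** The nonzero values are powers of 2, so a strict bound by one power improves to the next. *)
Lemma abs2_lt_half (x : Q2) (k : int) :
  (abs2 x < 2 ^ (- k)) = (abs2 x <= 2 ^ (- (k + 1))).
Proof.
have [->|/abs2_val[j ->]] := eqVneq x 0.
  by rewrite abs20 exprz_gt0// exprz_ge0.
by rewrite abs2_exp2 ltr_eXz2l// ler_eXz2l// !lerN2 ltrN2; apply/idP/idP; lia.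
Qed.

Lemma abs2_lt1 (x : Q2) : (abs2 x < 1) = (abs2 x <= 2^-1).
Proof. exact: (abs2_lt_half x 0). Qed.

Lemma abs2_lt1E (x : Q2) : (abs2 x < 1) = (abs2 (x / 2) <= 1).
Proof. by rewrite abs2_lt1 abs2M abs2V abs2_2 invrK -ler_pdivlMr// mul1r. Qed.

Lemma abs2Q_odd (q : rat) : abs2Q q = 1 ->
  odd `|numq q| /\ odd `|denq q|.
Proof.
rewrite /abs2Q; case: eqVneq => [->//|q0] h.
have : - v2Q q = 0 by apply: (@ieexprIz rat 2); rewrite ?h.
move=> /eqP; rewrite oppr_eq0 subr_eq0 => /eqP[{}h].
have c := coprime_num_den q.
have nd : ~~ ((2 %| `|numq q|)%N && (2 %| `|denq q|)%N).
  apply/negP => /andP[h1 h2]; have : (2 %| gcdn `|numq q| `|denq q|)%N.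
    by rewrite dvdn_gcd h1.
  by rewrite (eqP c).
have nn : (0 < `|numq q|)%N by rewrite absz_gt0 numq_eq0.
have dd : (0 < `|denq q|)%N by rewrite absz_gt0 denq_neq0.
move: nd (pfactor_dvdn 1 (isT : prime 2) nn) (pfactor_dvdn 1 (isT : prime 2) dd).
by rewrite h expn1 !dvdn2; case: (odd _); case: (odd _) => //= _ <-.
Qed.

(** The residue field is F_2: numerator and denominator are odd, so their difference is even. *)
Lemma abs2Q_unit_sub1 (q : rat) : abs2Q q = 1 -> abs2Q (q - 1) < 1.
Proof.
move=> /abs2Q_odd[on od].
have [->|q1] := eqVneq (q - 1) 0; first by rewrite abs2Q0.
have d0 : (denq q)%:~R != 0 :> rat by rewrite intr_eq0 denq_neq0.
have E : q - 1 = (numq q - denq q)%:~R / (denq q)%:~R.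
  by rewrite -{1}(divq_num_den q) intrB mulrBl divff.
have n0 : numq q - denq q != 0.
  by apply: contraNneq q1 => h; rewrite E h mul0r.
rewrite /abs2Q (negbTE q1) {1}E v2Q_frac ?denq_neq0//.
have -> : logn 2 `|denq q| = 0%N.
  by apply/eqP; rewrite logn_coprime// coprime2n.
have h : (0 < logn 2 `|numq q - denq q|)%N.
  rewrite -pfactor_dvdn ?absz_gt0//; move: on od; lia.
rewrite subr0 -[X in _ < X](expr0z 2) ltr_eXz2l//; move: h.
by case: (logn _ _).
Qed.

Lemma abs2_unit_sub1 (x : Q2) : abs2 x = 1 -> abs2 (x - 1) < 1.
Proof.
move=> x1; have x0 : x != 0 by rewrite -abs2_eq0E x1.
have [->|] := eqVneq (x - 1) 0; first by rewrite abs20.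
move: x0 x1; rewrite -[x]Q2_reprK -Q2_pi1 -Q2_piN -Q2_piD => x0 x1 s0.
have [N hN] := abs2Q_eventually x0; have [M hM] := abs2Q_eventually s0.
rewrite -(hM (maxn N M)) ?leq_maxr//; apply: abs2Q_unit_sub1.
by rewrite (hN (maxn N M)) ?leq_maxl.
Qed.

Lemma abs2_unit_add (x y : Q2) : abs2 x = 1 -> abs2 y = 1 -> abs2 (x + y) < 1.
Proof.
move=> /abs2_unit_sub1 hx /abs2_unit_sub1 hy.
have -> : x + y = (x - 1) + (y - 1) + 2 by ring.
by apply: abs2_lt_add; [exact: abs2_lt_add|rewrite abs2_2].
Qed.

Lemma abs2_lt1_mulr (x y : Q2) : abs2 x <= 1 -> abs2 y < 1 -> abs2 (x * y) < 1.
Proof.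
move=> hx hy; rewrite abs2M; apply: le_lt_trans hy.
by rewrite ler_piMl ?abs2_ge0.
Qed.

Lemma abs2_le1_mul (x y : Q2) : abs2 x <= 1 -> abs2 y <= 1 -> abs2 (x * y) <= 1.
Proof. by move=> hx hy; rewrite abs2M mulr_ile1 ?abs2_ge0. Qed.

(* Modulo 2 the form is x^2 + x y + y^2, which is anisotropic over F_2. *)
Lemma abs2_form_unit (A B C x y : Q2) :
  abs2 A = 1 -> abs2 B = 1 -> abs2 C = 1 ->
  Num.max (abs2 x) (abs2 y) = 1 ->
  abs2 (A * x ^+ 2 + B * x * y + C * y ^+ 2) = 1.
Proof.
move=> A1 B1 C1 xy1.
have [x1 y1] : abs2 x <= 1 /\ abs2 y <= 1.
  by rewrite -xy1 !le_max !lexx orbT.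
have [hx|] := ltP (abs2 x) 1.
  have y1' : abs2 y = 1.
    by move: xy1; rewrite /Num.max; case: ifP => // _ h; rewrite h ltxx in hx.
  rewrite addrC abs2_addl abs2M abs2X C1 y1' ?expr1n ?mulr1//.
  rewrite -mulrA expr2 mulrA; apply: abs2_lt_add.
    by rewrite abs2_lt1_mulr// abs2M A1 mul1r.
  by rewrite abs2M B1 mul1r mulrC abs2_lt1_mulr.
move=> x1g; have {}x1 : abs2 x = 1 by apply/le_anti; rewrite x1.
have [hy|] := ltP (abs2 y) 1.
  have -> : A * x ^+ 2 + B * x * y + C * y ^+ 2 =
      A * x ^+ 2 + (B * x + C * y) * y by ring.
  have e : abs2 (A * x ^+ 2) = 1 by rewrite abs2M abs2X A1 x1 expr1n mulr1.
  rewrite abs2_addl e// abs2_lt1_mulr// abs2_le_add// abs2M ?B1 ?C1 ?mul1r//.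
  by rewrite x1.
move=> y1g; have {}y1 : abs2 y = 1 by apply/le_anti; rewrite y1.
have e : abs2 (C * y ^+ 2) = 1 by rewrite abs2M abs2X C1 y1 expr1n mulr1.
rewrite addrC abs2_addl e//.
by apply: abs2_unit_add; rewrite !abs2M ?abs2X ?A1 ?B1 ?x1 ?y1 ?expr1n ?mulr1.
Qed.

Lemma abs2_lt_halfn (x : Q2) (k : nat) : (abs2 x < 2 ^- k) = (abs2 x <= 2 ^- k.+1).
Proof.
by have := abs2_lt_half x k%:Z; rewrite -PoszD addn1 -!exprnN.
Qed.

(** * Primitive coordinates and the chordal ultrametric on P^1(Q_2) *)

Definition cross (u v : Q2 * Q2) : Q2 := u.1 * v.2 - u.2 * v.1.

Definition primitive (u : Q2 * Q2) : Prop := Num.max (abs2 u.1) (abs2 u.2) = 1.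

Definition scale (k : Q2) (u : Q2 * Q2) : Q2 * Q2 := (k * u.1, k * u.2).

Definition mxact (a b c d : Q2) (u : Q2 * Q2) : Q2 * Q2 :=
  (a * u.1 + b * u.2, c * u.1 + d * u.2).

Definition proj_point (u : Q2 * Q2) : P1 :=
  if u.2 == 0 then None else Some (u.1 / u.2).

(* Primitive homogeneous coordinates: |x|_2 <= 1 decides which chart is used. *)
Definition crd (p : P1) : Q2 * Q2 :=
  if p is Some x then if abs2 x <= 1 then (x, 1) else (1, x^-1) else (1, 0).

(** The chordal distance. Primitive coordinates are unique up to a unit, so any of them give the
    same value ([rho_point]). *)
Definition rho (p q : P1) : rat := abs2 (cross (crd p) (crd q)).

Lemma primitive_le1 u : primitive u -> abs2 u.1 <= 1 /\ abs2 u.2 <= 1.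
Proof. by move=> <-; rewrite !le_max !lexx orbT. Qed.

Lemma primitiveP u : primitive u <->
  [/\ abs2 u.1 <= 1, abs2 u.2 <= 1 & abs2 u.1 = 1 \/ abs2 u.2 = 1].
Proof.
split=> [h|[h1 h2 h]].
  have [h1 h2] := primitive_le1 h; split=> //.
  by move: h; rewrite /primitive /Num.max; case: ifP => _; [right|left].
apply/le_anti; rewrite ge_max h1 h2 le_max /=.
by case: h => ->; rewrite lexx ?orbT.
Qed.

Lemma crd_primitive p : primitive (crd p).
Proof.
apply/primitiveP; case: p => [x|] /=; last by rewrite abs21 abs20; split=> //; left.
case: ifPn => /= [x1|]; first by rewrite abs21; split=> //; right.
rewrite -ltNge => x1; rewrite abs21 abs2V; split=> //; last by left.
by rewrite invf_le1 ?(lt_trans _ x1)// ltW.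
Qed.

Lemma primitive_neq0 u : primitive u -> (u.1 != 0) || (u.2 != 0).
Proof.
rewrite -negb_and => h; apply/negP => /andP[/eqP u1 /eqP u2].
by move: h; rewrite /primitive u1 u2 abs20 maxxx => /esym/eqP; rewrite oner_eq0.
Qed.

Lemma crdK p : proj_point (crd p) = p.
Proof.
rewrite /proj_point; case: p => [x|] /=; last by rewrite eqxx.
case: (boolP (abs2 x <= 1)) => /= [_|]; first by rewrite oner_eq0 divr1.
rewrite -ltNge => x1; have x0 : x != 0 by rewrite -abs2_gt0 (lt_trans _ x1).
by rewrite invr_eq0 (negbTE x0) invrK mul1r.
Qed.

Lemma point_scale k u : k != 0 -> proj_point (scale k u) = proj_point u.
Proof.
move=> k0; rewrite /proj_point /= mulf_eq0 (negbTE k0) /=.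
by case: eqVneq => // u2; rewrite -mulf_div divff// mul1r.
Qed.

Lemma crd_point u : (u.1 != 0) || (u.2 != 0) ->
  exists2 k, k != 0 & crd (proj_point u) = scale k u.
Proof.
case: u => x y /=; rewrite /proj_point /=; have [->|y0 _] := eqVneq y 0.
  rewrite orbF => x0; exists x^-1; first by rewrite invr_eq0.
  by rewrite /scale /= mulr0 mulVf.
rewrite /crd /=; case: ifPn => [_|].
  exists y^-1; first by rewrite invr_eq0.
  by rewrite /scale /= mulVf// mulrC.
rewrite -ltNge => xy; have x0 : x != 0.
  by apply: contraTneq xy => ->; rewrite mul0r abs20.
exists x^-1; first by rewrite invr_eq0.
by rewrite /scale /= mulVf// invfM invrK.
Qed.

Lemma mobius_point a b c d p : mobius a b c d p = proj_point (mxact a b c d (crd p)).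
Proof.
rewrite /mxact /proj_point; case: p => [x|] /=; last first.
  by rewrite !mulr0 !mulr1 !addr0.
case: (boolP (abs2 x <= 1)) => /= [_|]; first by rewrite !mulr1.
rewrite -ltNge => x1; have x0 : x != 0 by rewrite -abs2_gt0 (lt_trans _ x1).
have e e1 e2 : e1 * 1 + e2 * x^-1 = (e1 * x + e2) / x :> Q2.
  by rewrite mulr1 mulrDl mulfK.
by rewrite !e mulf_eq0 invr_eq0 (negbTE x0) orbF -mulf_div divff ?invr_eq0// mulr1.
Qed.

Lemma mxact_scale a b c d k u :
  mxact a b c d (scale k u) = scale k (mxact a b c d u).
Proof. by rewrite /mxact /scale /=; congr pair; ring. Qed.

Lemma mxact_neq0 a b c d u : a * d - b * c != 0 ->
  (u.1 != 0) || (u.2 != 0) ->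
  ((mxact a b c d u).1 != 0) || ((mxact a b c d u).2 != 0).
Proof.
case: u => x y /= D0 xy.
case: (eqVneq (a * x + b * y) 0) => //= e1.
case: (eqVneq (c * x + d * y) 0) => //= e2.
have ex : (a * d - b * c) * x = d * (a * x + b * y) - b * (c * x + d * y) by ring.
have ey : (a * d - b * c) * y = a * (c * x + d * y) - c * (a * x + b * y) by ring.
move: ex ey xy; rewrite e1 e2 !mulr0 subr0 => /eqP ex /eqP ey.
by move: ex ey; rewrite !mulf_eq0 !(negbTE D0) /= => -> ->.
Qed.

Lemma mobius_comp a b c d a' b' c' d' p : a' * d' - b' * c' != 0 ->
  mobius a b c d (mobius a' b' c' d' p) =
  mobius (a * a' + b * c') (a * b' + b * d') (c * a' + d * c') (c * b' + d * d') p.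
Proof.
move=> D0; rewrite !mobius_point.
have [k k0 ->] := crd_point (mxact_neq0 D0 (primitive_neq0 (crd_primitive p))).
rewrite mxact_scale point_scale//; congr proj_point; rewrite /mxact /=.
by congr pair; ring.
Qed.

Lemma mobius_scale k a b c d p : k != 0 ->
  mobius (k * a) (k * b) (k * c) (k * d) p = mobius a b c d p.
Proof.
move=> k0; rewrite !mobius_point -(point_scale (mxact a b c d _) k0); congr proj_point.
by rewrite /mxact /scale /=; congr pair; ring.
Qed.

Lemma mobius_id p : mobius 1 0 0 1 p = p.
Proof.
case: p => [x|] /=; last by rewrite eqxx.
by rewrite mul0r add0r oner_eq0 mul1r addr0 divr1.
Qed.

Lemma affine_mobius eta beta p : affine eta beta p = mobius eta beta 0 1 p.
Proof.
case: p => [x|] /=; last by rewrite eqxx.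
by rewrite mul0r add0r oner_eq0 divr1.
Qed.

Lemma primitive_scale k u : primitive u -> primitive (scale k u) -> abs2 k = 1.
Proof.
rewrite /primitive /= !abs2M -maxr_pMr ?abs2_ge0// => ->.
by rewrite mulr1.
Qed.

Lemma rho_point u v : primitive u -> primitive v ->
  rho (proj_point u) (proj_point v) = abs2 (cross u v).
Proof.
move=> pu pv; have [k k0 ek] := crd_point (primitive_neq0 pu).
have [l l0 el] := crd_point (primitive_neq0 pv).
have k1 : abs2 k = 1.
  by apply: (primitive_scale pu); rewrite -ek; exact: crd_primitive.
have l1 : abs2 l = 1.
  by apply: (primitive_scale pv); rewrite -el; exact: crd_primitive.
rewrite /rho ek el -[RHS]mul1r -[1]mul1r -{1}k1 -l1 -!abs2M; congr abs2.
by rewrite /cross /=; ring.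
Qed.

Lemma rho_refl p : rho p p = 0.
Proof. by rewrite /rho /cross mulrC subrr abs20. Qed.

Lemma rho_sym p q : rho p q = rho q p.
Proof.
by rewrite /rho /cross -abs2N opprB; congr (abs2 (_ - _)); rewrite mulrC.
Qed.

(* Pluecker: [u,w] v = [u,v] w + [v,w] u, and some coordinate of v is a unit. *)
Lemma cross_ultra u v w : primitive u -> primitive v -> primitive w ->
  abs2 (cross u w) <= Num.max (abs2 (cross u v)) (abs2 (cross v w)).
Proof.
move=> /primitive_le1[u1 u2] /primitiveP[_ _ hv] /primitive_le1[w1 w2].
have key x y : abs2 x <= 1 -> abs2 y <= 1 ->
    abs2 (cross u v * x + cross v w * y) <=
    Num.max (abs2 (cross u v)) (abs2 (cross v w)).
  move=> x1 y1; apply: abs2_le_add; rewrite abs2M le_max.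
    by rewrite ler_piMr ?abs2_ge0.
  by rewrite [X in _ || X]ler_piMr ?abs2_ge0 ?orbT.
case: hv => hv; rewrite -[leLHS]mulr1 -hv -abs2M.
  have -> : cross u w * v.1 = cross u v * w.1 + cross v w * u.1.
    by rewrite /cross; ring.
  exact: key.
have -> : cross u w * v.2 = cross u v * w.2 + cross v w * u.2.
  by rewrite /cross; ring.
exact: key.
Qed.

Lemma rho_ultra q p r : rho p r <= Num.max (rho p q) (rho q r).
Proof. by apply: cross_ultra; exact: crd_primitive. Qed.

Lemma rho_eq0 p q : rho p q = 0 -> p = q.
Proof.
move=> /eqP; rewrite abs2_eq0E subr_eq0 => /eqP e.
rewrite -[p]crdK -[q]crdK /proj_point.
have /orP[p0|p0] := primitive_neq0 (crd_primitive p);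
have /orP[q0|q0] := primitive_neq0 (crd_primitive q).
- have [p2|p2] := eqVneq (crd p).2 0.
    move: e; rewrite p2 mul0r => /eqP; rewrite mulf_eq0 (negbTE p0) /= => /eqP ->.
    by rewrite eqxx.
  have q2 : (crd q).2 != 0.
    apply: contraTneq q0 => q2; move: e; rewrite q2 mulr0 => /esym/eqP.
    by rewrite mulf_eq0 (negbTE p2) /= => /eqP ->; rewrite eqxx.
  rewrite (negbTE q2); congr Some; apply/eqP; rewrite eqr_div//.
  by rewrite e mulrC.
- have p2 : (crd p).2 != 0.
    apply: contraTneq p0 => p2; move: e; rewrite p2 mul0r => /eqP.
    by rewrite mulf_eq0 (negbTE q0) orbF => /eqP ->; rewrite eqxx.
  rewrite (negbTE q0) (negbTE p2); congr Some; apply/eqP; rewrite eqr_div//.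
  by rewrite e mulrC.
- have q2 : (crd q).2 != 0.
    apply: contraTneq q0 => q2; move: e; rewrite q2 mulr0 => /esym/eqP.
    by rewrite mulf_eq0 (negbTE p0) /= => /eqP ->; rewrite eqxx.
  rewrite (negbTE q2) (negbTE p0); congr Some; apply/eqP; rewrite eqr_div//.
  by rewrite e mulrC.
- rewrite (negbTE q0) (negbTE p0); congr Some; apply/eqP; rewrite eqr_div//.
  by rewrite e mulrC.
Qed.

(** By Cramer's rule, if both coordinates of the image were non-units then so would be both
    coordinates of [u]. *)
Lemma mxact_primitive a b c d u : abs2 a <= 1 -> abs2 b <= 1 -> abs2 c <= 1 ->
  abs2 d <= 1 -> abs2 (a * d - b * c) = 1 -> primitive u ->
  primitive (mxact a b c d u).
Proof.
case: u => x y a1 b1 c1 d1 D1 /primitiveP /= [x1 y1 xy].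
have h1 : abs2 (a * x + b * y) <= 1 by apply: abs2_le_add; exact: abs2_le1_mul.
have h2 : abs2 (c * x + d * y) <= 1 by apply: abs2_le_add; exact: abs2_le1_mul.
apply/primitiveP => /=; split=> //.
have [l1|] := ltP (abs2 (a * x + b * y)) 1; last by left; apply/le_anti; rewrite h1.
have [l2|] := ltP (abs2 (c * x + d * y)) 1; last by right; apply/le_anti; rewrite h2.
have e1 : abs2 x < 1.
  rewrite -[abs2 x]mul1r -{1}D1 -abs2M.
  have -> : (a * d - b * c) * x = d * (a * x + b * y) - b * (c * x + d * y) by ring.
  by apply: abs2_lt_sub; exact: abs2_lt1_mulr.
have e2 : abs2 y < 1.
  rewrite -[abs2 y]mul1r -{1}D1 -abs2M.
  have -> : (a * d - b * c) * y = a * (c * x + d * y) - c * (a * x + b * y) by ring.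
  by apply: abs2_lt_sub; exact: abs2_lt1_mulr.
by exfalso; case: xy => h; rewrite h ltxx in e1 e2.
Qed.

(** An element of GL_2(Z_2) keeps coordinates primitive and multiplies [cross] by its determinant, a
    unit. *)
Lemma rho_mobius a b c d p q : abs2 a <= 1 -> abs2 b <= 1 -> abs2 c <= 1 ->
  abs2 d <= 1 -> abs2 (a * d - b * c) = 1 ->
  rho (mobius a b c d p) (mobius a b c d q) = rho p q.
Proof.
move=> a1 b1 c1 d1 D1; rewrite !mobius_point.
rewrite rho_point; [|exact: mxact_primitive (crd_primitive _)..].
rewrite /rho -[RHS]mul1r -D1 -abs2M; congr abs2.
by rewrite /cross /mxact /=; ring.
Qed.

(* If [g,r] and [r,q] both have absolute value exactly 2^-k, then their sum   *)
(* is smaller, the residue field of Q_2 having only one unit.                 *)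
Lemma rho_half k p q r : (0 < k)%N -> rho q p = 2 ^- k -> rho p r = 2 ^- k ->
  rho q r < 2 ^- k.
Proof.
move=> k0; rewrite /rho.
have /primitiveP[p1 p2 hp] := crd_primitive p.
have [q1 q2] := primitive_le1 (crd_primitive q).
have [r1 r2] := primitive_le1 (crd_primitive r).
move: p1 p2 q1 q2 r1 r2 hp; set u := crd p; set v := crd q; set w := crd r.
move=> u1 u2 v1 v2 w1 w2 hu ev ew.
have k1 : 2 ^- k < 1 :> rat by rewrite invf_lt1 ?exprn_gt0// exprn_egt1// -lt0n.
have T : abs2 (2 ^+ k : Q2) = 2 ^- k by rewrite abs2X abs2_2 exprVn.
have T0 : (2 ^+ k : Q2) != 0 by rewrite expf_neq0 ?Q2_2neq0.
pose A := cross v u / 2 ^+ k; pose C := cross u w / 2 ^+ k.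
have A1 : abs2 A = 1 by rewrite abs2M abs2V T ev divff// invr_neq0// expf_neq0.
have C1 : abs2 C = 1 by rewrite abs2M abs2V T ew divff// invr_neq0// expf_neq0.
have unit_mul x y : abs2 x = 1 -> abs2 y = 1 -> abs2 (x * y) = 1.
  by rewrite abs2M => -> ->; rewrite mulr1.
have eA : cross v u = 2 ^+ k * A by rewrite mulrC divfK.
have eC : cross u w = 2 ^+ k * C by rewrite mulrC divfK.
suff h : abs2 ((cross v w) / 2 ^+ k) < 1.
  move: h; rewrite abs2M abs2V T invrK.
  by rewrite -ltr_pdivlMr ?mul1r ?exprn_gt0.
have lt1 x : abs2 x <= 1 -> abs2 (2 ^+ k * x) < 1.
  by move=> x1; rewrite mulrC abs2_lt1_mulr// T.
case: hu => hu.
  (* Distances below 1 mean equal reductions modulo 2, so the coordinate that is a unit in [u] is a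
     unit in [v] and [w] too. The Pluecker relation then writes the cross product of [v] and [w], up
     to a unit, as 2^k times a sum of two units. *)
  have vw : abs2 v.1 = 1 /\ abs2 w.1 = 1.
    split; apply/le_anti; rewrite ?v1 ?w1 /= leNgt; apply/negP => h.
      have v2' : abs2 v.2 = 1.
        have /primitiveP[_ _ []//] := crd_primitive q.
        by rewrite -/v => h'; rewrite h' ltxx in h.
      have : abs2 (cross v u) < 1 by rewrite eA lt1// A1.
      rewrite /cross -abs2N opprB abs2_addl ?abs2N ?abs2M ?v2' ?hu ?mulr1 ?ltxx//.
      by apply: le_lt_trans h; rewrite ler_piMr ?abs2_ge0.
    have w2' : abs2 w.2 = 1.
      have /primitiveP[_ _ []//] := crd_primitive r.
      by rewrite -/w => h'; rewrite h' ltxx in h.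
    have : abs2 (cross u w) < 1 by rewrite eC lt1// C1.
    rewrite /cross abs2_addl ?abs2N ?abs2M ?w2' ?hu ?mulr1 ?ltxx//.
    by apply: le_lt_trans h; rewrite ler_piMl ?abs2_ge0.
  have [v1' w1u] := vw.
  rewrite -[ltLHS]mulr1 -[X in _ * X]hu -abs2M.
  have -> : cross v w / 2 ^+ k * u.1 = A * w.1 + C * v.1.
    by rewrite /A /C /cross; move: (2 ^+ k)^-1 => z; ring.
  by apply: abs2_unit_add; exact: unit_mul.
have vw : abs2 v.2 = 1 /\ abs2 w.2 = 1.
  split; apply/le_anti; rewrite ?v2 ?w2 /= leNgt; apply/negP => h.
    have v1' : abs2 v.1 = 1.
      have /primitiveP[_ _ []//] := crd_primitive q.
      by rewrite -/v => h'; rewrite h' ltxx in h.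
    have : abs2 (cross v u) < 1 by rewrite eA lt1// A1.
    rewrite /cross abs2_addl ?abs2N ?abs2M ?v1' ?hu ?mulr1 ?ltxx//.
    by apply: le_lt_trans h; rewrite ler_piMr ?abs2_ge0.
  have w1' : abs2 w.1 = 1.
    have /primitiveP[_ _ []//] := crd_primitive r.
    by rewrite -/w => h'; rewrite h' ltxx in h.
  have : abs2 (cross u w) < 1 by rewrite eC lt1// C1.
  rewrite /cross -abs2N opprB abs2_addl ?abs2N ?abs2M ?w1' ?hu ?mulr1 ?ltxx//.
  by apply: le_lt_trans h; rewrite ler_piMl ?abs2_ge0.
have [v2' w2'] := vw.
rewrite -[ltLHS]mulr1 -[X in _ * X]hu -abs2M.
have -> : cross v w / 2 ^+ k * u.2 = A * w.2 + C * v.2.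
  by rewrite /A /C /cross; move: (2 ^+ k)^-1 => z; ring.
by apply: abs2_unit_add; exact: unit_mul.
Qed.

(** * The action of Q_2[N] on P^1(Q_2) and its orbits *)

Definition pmul (n : Q2) (z w : Q2 * Q2) : Q2 * Q2 :=
  (z.1 * w.1 + n * z.2 * w.2, z.1 * w.2 + z.2 * w.1 + z.2 * w.2).

(* The pair (x, y) stands for x + y N with N = [[1, n1], [n2, 0]], so that    *)
(* N^2 = N + n1 n2 and pmul is the multiplication of Q_2[N].                  *)
Definition mobN (n1 n2 : Q2) (z : Q2 * Q2) (p : P1) : P1 :=
  mobius (z.1 + z.2) (z.2 * n1) (z.2 * n2) z.1 p.

(** The form is the norm of x + y N for [n] = n1 n2, that is, the determinant of the matrix. *)
Lemma norm_unit n x y : abs2 n = 1 -> primitive (x, y) ->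
  abs2 (x ^+ 2 + x * y - n * y ^+ 2) = 1.
Proof.
move=> n1 /(@abs2_form_unit 1 1 (- n) x y abs21 abs21).
by rewrite abs2N => /(_ n1); rewrite !mul1r mulNr.
Qed.

Lemma mobN_det n1 n2 z : abs2 n1 = 1 -> abs2 n2 = 1 -> primitive z ->
  abs2 ((z.1 + z.2) * z.1 - z.2 * n1 * (z.2 * n2)) = 1.
Proof.
case: z => x y n11 n21 /(@norm_unit (n1 * n2)); rewrite abs2M n11 n21 mulr1.
by move=> /(_ erefl) <-; congr abs2 => /=; ring.
Qed.

Lemma pmul_primitive n z w : abs2 n = 1 -> primitive z -> primitive w ->
  primitive (pmul n z w).
Proof.
case: z w => x y [x' y'] n1 pz pw.
have [/= x1 y1] := primitive_le1 pz.
have -> : pmul n (x, y) (x', y') = mxact x (n * y) y (x + y) (x', y').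
  by rewrite /pmul /mxact /=; congr pair; ring.
apply: mxact_primitive => //; first by rewrite abs2M n1 mul1r.
  exact: abs2_le_add.
by rewrite -(norm_unit n1 pz); congr abs2; ring.
Qed.

Lemma abs2_unit_neq0 x : abs2 x = 1 -> x != 0.
Proof. by move=> x1; rewrite -abs2_eq0E x1. Qed.

Lemma mobN_comp n1 n2 z w p : abs2 n1 = 1 -> abs2 n2 = 1 -> primitive w ->
  mobN n1 n2 z (mobN n1 n2 w p) = mobN n1 n2 (pmul (n1 * n2) z w) p.
Proof.
move=> n11 n21 pw; rewrite /mobN mobius_comp; last first.
  exact/abs2_unit_neq0/mobN_det.
by case: z w {pw} => x y [x' y']; congr mobius => /=; ring.
Qed.

Lemma rho_mobN n1 n2 z p q : abs2 n1 = 1 -> abs2 n2 = 1 -> primitive z ->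
  rho (mobN n1 n2 z p) (mobN n1 n2 z q) = rho p q.
Proof.
move=> n11 n21 pz; have [x1 y1] := primitive_le1 pz.
rewrite rho_mobius//; first exact: abs2_le_add.
- by rewrite abs2M n11 mulr1.
- by rewrite abs2M n21 mulr1.
- exact: mobN_det.
Qed.

(** The cross product of p = (p1, p2) with its image is y (n2 p1^2 - p1 p2 - n1 p2^2), and the form
    in brackets takes unit values on primitive vectors. *)
Lemma rho_mobN_displacement n1 n2 z p : abs2 n1 = 1 -> abs2 n2 = 1 ->
  primitive z -> rho (mobN n1 n2 z p) p = abs2 z.2.
Proof.
move=> n11 n21 pz; have [x1 y1] := primitive_le1 pz.
rewrite rho_sym -[X in rho X _](crdK p) /mobN mobius_point.
have pp := crd_primitive p.
rewrite rho_point//; last first.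
  apply: mxact_primitive => //; first exact: abs2_le_add.
  - by rewrite abs2M n11 mulr1.
  - by rewrite abs2M n21 mulr1.
  - exact: mobN_det.
have n11' : abs2 (- n1) = 1 by rewrite abs2N.
have m1 : abs2 (-1) = 1 by rewrite abs2N abs21.
have := abs2_form_unit n21 m1 n11' pp.
move=> h; rewrite -[RHS]mulr1 -h -abs2M; congr abs2.
by rewrite /cross /mxact /=; ring.
Qed.

(** The new second coordinate is y (2 x + y); as |y| <= 1/4 and x is a unit, |2 x + y| = 1/2. *)
Lemma mobN_square n1 n2 z k : abs2 n1 = 1 -> abs2 n2 = 1 -> primitive z ->
  (2 <= k)%N -> abs2 z.2 = 2 ^- k ->
  abs2 (pmul (n1 * n2) z z).2 = 2 ^- k.+1.
Proof.
case: z => x y n11 n21 /= pz k2 yk; rewrite /pmul /=.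
have y4 : abs2 y <= 2 ^- 2.
  by rewrite yk lef_pV2 ?posrE ?exprn_gt0// ler_eXn2l.
have x1 : abs2 x = 1.
  have /primitiveP[_ _ []//= y1] := pz.
  by move: y4; rewrite y1.
have -> : x * y + y * x + y * y = y * (2 * x + y) by ring.
rewrite abs2M abs2_addl abs2M abs2_2 x1 mulr1.
  by rewrite yk exprS invfM mulrC.
exact: le_lt_trans y4 _.
Qed.

Lemma mobN_levels n1 n2 z m j : abs2 n1 = 1 -> abs2 n2 = 1 -> primitive z ->
  (2 <= m)%N -> abs2 z.2 = 2 ^- m ->
  exists i w, [/\ primitive w, abs2 w.2 = 2 ^- (m + j) &
    forall p, mobN n1 n2 w p = iter i (mobN n1 n2 z) p].
Proof.
move=> n11 n21 pz m2 zm; elim: j => [|j [i [w [pw wj hw]]]].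
  by exists 1%N, z; rewrite addn0.
exists (i + i)%N, (pmul (n1 * n2) w w); split.
- by apply: pmul_primitive => //; rewrite abs2M n11 n21 mulr1.
- by rewrite addnS; apply: mobN_square => //; rewrite (leq_trans m2)// leq_addr.
- by move=> p; rewrite -mobN_comp// !hw iterD.
Qed.

(** If the current point is at distance exactly 2^-(m+k) from [q], an iterate with exactly that
    displacement carries it into the half-ball of [q], by [rho_half]. *)
Lemma mobN_orbit_dense n1 n2 z m p q k : abs2 n1 = 1 -> abs2 n2 = 1 ->
  primitive z -> (2 <= m)%N -> abs2 z.2 = 2 ^- m -> rho p q <= 2 ^- m ->
  exists i, rho (iter i (mobN n1 n2 z) p) q <= 2 ^- k.
Proof.
move=> n11 n21 pz m2 zm pq.
suff [i hi] : exists i, rho (iter i (mobN n1 n2 z) p) q <= 2 ^- (m + k).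
  exists i; apply: le_trans hi _.
  by rewrite lef_pV2 ?posrE ?exprn_gt0// ler_eXn2l// leq_addl.
elim: k => [|k [i hi]]; first by exists 0%N; rewrite addn0.
have [lt|ge] := ltP (rho (iter i (mobN n1 n2 z) p) q) (2 ^- (m + k)).
  by exists i; rewrite addnS -abs2_lt_halfn.
have {hi ge} e : rho (iter i (mobN n1 n2 z) p) q = 2 ^- (m + k).
  by apply/le_anti; rewrite hi.
have [j [w [pw wk hw]]] := mobN_levels k n11 n21 pz m2 zm.
exists (j + i)%N; rewrite iterD -hw addnS -abs2_lt_halfn.
apply: rho_half e; first by rewrite addn_gt0 (leq_trans _ m2).
by rewrite rho_mobN_displacement.
Qed.

Definition pcube (n : Q2) (z : Q2 * Q2) : Q2 * Q2 := pmul n z (pmul n z z).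

Definition psix (n : Q2) (z : Q2 * Q2) : Q2 * Q2 := pmul n (pcube n z) (pcube n z).

(** The units of F_4 have order dividing 3, so the cube is congruent to an element of Z_2 modulo 2;
    squaring multiplies its even y by the even number 2 x + y. *)
Lemma psix_level n z : abs2 n = 1 -> primitive z -> abs2 (psix n z).2 <= 2 ^- 2.
Proof.
rewrite /psix => n1; case: z => x y pz; set z3 := pcube _ _.
have [x1 y1] := primitive_le1 pz; rewrite /= in x1 y1.
have n1' : abs2 (n + 1) < 1 by rewrite abs2_unit_add// abs21.
have x31 : abs2 z3.1 <= 1.
  by have [] := primitive_le1 (pmul_primitive n1 pz (pmul_primitive n1 pz pz)).
have y31 : abs2 z3.2 < 1.
  have -> : z3.2 = 3 * (x * y * (x + y)) + y * y * y * (n + 1).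
    by rewrite /z3 /pcube /pmul /=; ring.
  apply: abs2_lt_add; last by rewrite abs2_lt1_mulr// !abs2_le1_mul.
  rewrite abs2_lt1_mulr//; first by rewrite abs2_nat.
  (* One of x, y, x + y is even. *)
  have [hx|hx] := ltP (abs2 x) 1.
    have -> : x * y * (x + y) = y * (x + y) * x by ring.
    by rewrite abs2_lt1_mulr// abs2_le1_mul// abs2_le_add.
  have [hy|hy] := ltP (abs2 y) 1.
    have -> : x * y * (x + y) = x * (x + y) * y by ring.
    by rewrite abs2_lt1_mulr// abs2_le1_mul// abs2_le_add.
  by rewrite abs2_lt1_mulr ?abs2_le1_mul// abs2_unit_add//; apply/le_anti;
    rewrite ?x1 ?y1.
have -> : (pmul n z3 z3).2 = z3.2 * (2 * z3.1 + z3.2) by rewrite /pmul /=; ring.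
rewrite abs2M expr2 invfM ler_pM ?abs2_ge0// -abs2_lt1//.
apply: abs2_lt_add => //; rewrite mulrC abs2_lt1_mulr// abs2_2.
by [].
Qed.

Lemma abs2_pow2 (x : Q2) : x != 0 -> abs2 x <= 1 ->
  exists k, abs2 x = 2 ^- k.
Proof.
move=> /abs2_val[[k|k] ->]; rewrite abs2_exp2.
  by exists k; rewrite -exprnN.
rewrite NegzE opprK -[leRHS](expr0z 2%:R) ler_eXz2l//.
Qed.

Lemma mobN_dense n1 n2 z : abs2 n1 = 1 -> abs2 n2 = 1 -> primitive z ->
  (psix (n1 * n2) z).2 != 0 ->
  exists m, forall p q k, rho p q <= 2 ^- m ->
    exists i, rho (iter i (mobN n1 n2 z) p) q <= 2 ^- k.
Proof.
move=> n11 n21 pz z60.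
have n1n2 : abs2 (n1 * n2) = 1 by rewrite abs2M n11 n21 mulr1.
have pz2 : primitive (pmul (n1 * n2) z z) by exact: pmul_primitive.
have pz3 : primitive (pcube (n1 * n2) z) by exact: pmul_primitive.
have pz6 : primitive (psix (n1 * n2) z) by exact: pmul_primitive.
have l4 := psix_level n1n2 pz.
have [_ l1] := primitive_le1 pz6.
have [m em] := abs2_pow2 z60 l1.
exists m => p q k pq.
have m2 : (2 <= m)%N.
  by move: l4; rewrite em lef_pV2 ?posrE ?exprn_gt0// ler_eXn2l.
have [i hi] := mobN_orbit_dense k n11 n21 pz6 m2 em pq.
exists (i * 6)%N; rewrite iterM.
have h6 r : iter 6 (mobN n1 n2 z) r = mobN n1 n2 (psix (n1 * n2) z) r.
  by rewrite /psix -mobN_comp// /pcube -!mobN_comp.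
by rewrite (eq_iter h6).
Qed.

(** * Topology of Q_2 and compactness of Z_2 *)

Lemma pow2_lt (e : rat) : 0 < e -> exists N, 2 ^- N < e.
Proof.
move=> e0; exists (Num.bound e^-1); rewrite invf_plt ?posrE ?exprn_gt0//.
apply: (lt_trans (archi_boundP _)); first by rewrite invr_ge0 ltW.
by rewrite -natrX ltr_nat ltn_expl.
Qed.

Lemma Q2_complete (u : nat -> nat) :
  (forall m n, (n <= m)%N -> abs2Q ((u m)%:R - (u n)%:R) <= 2 ^- n) ->
  exists x : Q2, forall n, abs2 (x - (u n)%:R) <= 2 ^- n.
Proof.
move=> hu.
have cu : (fun n => (u n)%:R : rat) \in cauchy2_pred.
  apply/asboolP => e e0; have [N hN] := pow2_lt e0.
  have hh n : (N <= n)%N -> abs2Q ((u n)%:R - (u N)%:R) < e.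
    by move=> Nn; apply: le_lt_trans hN; exact: hu.
  exists N => m n Nm Nn.
  rewrite -(subrKA (u N)%:R); apply: le_lt_trans (abs2Q_ultra _ _) _.
  by rewrite gt_max hh// -abs2QN opprB hh.
exists (Q2_pi (Cauchy2Seq cu)) => n.
rewrite natr_const2 -Q2_piN -Q2_piD.
have [->|h0] := eqVneq (Q2_pi (Cauchy2Seq cu + - const2 (u n)%:R)) 0.
  by rewrite abs20 invr_ge0 exprn_ge0.
have [N hN] := abs2Q_eventually h0.
rewrite -(hN (maxn N n)) ?leq_maxl//; apply: hu.
exact: leq_maxr.
Qed.

Lemma Q2_nbhsP (x : Q2) (U : set Q2) :
  nbhs x U <-> exists k, forall y, abs2 (y - x) <= 2 ^- k -> U y.
Proof.
split=> [/nbhs_ballP[e /= e0 xU]|[k hk]].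
  have [k ke] := pow2_lt e0; exists k => y yx; apply: xU.
  by rewrite ballEmdist /= /mdist /= /dist2 abs2_distC (le_lt_trans yx).
apply/nbhs_ballP; exists (2 ^- k); first by rewrite /= invr_gt0 exprn_gt0.
move=> y; rewrite ballEmdist /= => /ltW.
by rewrite /mdist /= /dist2 abs2_distC; exact: hk.
Qed.

Lemma Q2_affine_continuous (u v : Q2) : continuous (fun y : Q2 => u * y + v).
Proof.
move=> x U /Q2_nbhsP[k hk]; apply/Q2_nbhsP.
have e0 : 0 < 2 ^- k / (1 + abs2 u) :> rat.
  by rewrite divr_gt0 ?invr_gt0 ?exprn_gt0// ltr_pwDl// abs2_ge0.
have [j hj] := pow2_lt e0; exists j => y yx; apply: hk.
rewrite opprD addrACA subrr addr0 -mulrBr abs2M.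
have yx' := le_trans yx (ltW hj).
apply: (@le_trans _ _ ((1 + abs2 u) * abs2 (y - x))).
  by rewrite ler_wpM2r ?abs2_ge0// lerDr.
by rewrite mulrC -ler_pdivlMr// ltr_pwDl// abs2_ge0.
Qed.

(* An ultrafilter on Z_2 chooses one of the two halves of each ball, which    *)
(* yields the digits of its limit.                                            *)
Lemma compact_Z2 : compact Z2.
Proof.
rewrite compact_ultra => F FF FZ.
pose D (k a : nat) : set Q2 := [set x | abs2 (x - a%:R) <= 2 ^- k].
pose a := fix a k := if k is j.+1 then
  (if `[< F (D j.+1 (a j)) >] then a j else (a j + 2 ^ j)%N) else 0%N.
(* If |x - b| is exactly 2^-k then (x - b) / 2^k is a unit, hence congruent to 1: the next digit is
   1. *)
have split k b : D k b `<=` D k.+1 b `|` D k.+1 (b + 2 ^ k)%N.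
  move=> x; rewrite /D /= => hx.
  have [h|h] := ltP (abs2 (x - b%:R)) (2 ^- k); first by left; rewrite -abs2_lt_halfn.
  right; rewrite -abs2_lt_halfn.
  have T0 : (2 ^+ k : Q2) != 0 by rewrite expf_neq0 ?Q2_2neq0.
  have T : abs2 (2 ^+ k : Q2) = 2 ^- k by rewrite abs2X abs2_2 exprVn.
  have : abs2 ((x - b%:R) / 2 ^+ k) = 1.
    have -> : abs2 ((x - b%:R) / 2 ^+ k) = abs2 (x - b%:R) / 2 ^- k.
      by rewrite abs2M abs2V T.
    have -> : abs2 (x - b%:R) = 2 ^- k by apply/le_anti; rewrite hx.
    by rewrite divff// invr_neq0// expf_neq0.
  move=> /abs2_unit_sub1.
  have -> : (x - b%:R) / 2 ^+ k - 1 = (x - (b + 2 ^ k)%:R) / 2 ^+ k.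
    by rewrite natrD natrX opprD addrA [RHS]mulrBl divff.
  by rewrite abs2M abs2V T -ltr_pdivlMr ?invr_gt0 ?invr_gt0 ?exprn_gt0// invrK mul1r.
have Fa k : F (D k (a k)).
  elim: k => [|k IH].
    by apply: filterS FZ => x; rewrite /D /Z2 /= subr0.
  rewrite /=; case: asboolP => // nF.
  have [//|FC] := in_ultra_setVsetC (D k.+1 (a k)) FF.
  apply: filterS (filterI IH FC) => x [/split[//|//]].
have step k : abs2Q ((a k.+1)%:R - (a k)%:R) <= 2 ^- k.
  rewrite /=; case: asboolP => _; first by rewrite subrr abs2Q0 invr_ge0 exprn_ge0.
  rewrite natrD addrAC subrr add0r -abs2_nat natrX abs2X abs2_2 exprVn.
  by [].
have ha m n : (n <= m)%N -> abs2Q ((a m)%:R - (a n)%:R) <= 2 ^- n.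
  elim: m => [|m IH]; first by rewrite leqn0 => /eqP ->; rewrite subrr abs2Q0 invr_ge0 exprn_ge0.
  rewrite leq_eqVlt => /predU1P[<-|]; first by rewrite subrr abs2Q0 invr_ge0 exprn_ge0.
  rewrite ltnS => nm; rewrite -(subrKA (a m)%:R).
  apply: le_trans (abs2Q_ultra _ _) _; rewrite ge_max IH// andbT.
  apply: le_trans (step m) _.
  by rewrite lef_pV2 ?posrE ?exprn_gt0// ler_eXn2l.
have [x hx] := Q2_complete ha.
exists x; split.
  have := hx 0%N; rewrite /= subr0.
  by [].
move=> U /Q2_nbhsP[k hk]; apply: filterS (Fa k) => y hy; apply: hk.
by rewrite -(subrKA (a k)%:R) abs2_le_add// abs2_distC.
Qed.

Lemma compact_affine_Z2 (u v : Q2) : compact [set u * y + v | y in Z2].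
Proof.
apply: continuous_compact compact_Z2.
exact/continuous_subspaceT/Q2_affine_continuous.
Qed.

Lemma Q2_hausdorff : hausdorff_space Q2.
Proof. exact: metric_hausdorff. Qed.

(** * Cells as a base of the topology and a pi-system for the Borel sets *)

Definition unaffine (eta beta : Q2) : P1 -> P1 := affine eta^-1 (- (beta / eta)).

Lemma affineK eta beta : eta != 0 -> cancel (affine eta beta) (unaffine eta beta).
Proof.
move=> e0 [x|//] /=; rewrite mulrDr mulKf//; congr Some.
by rewrite [beta / eta]mulrC addrK.
Qed.

Lemma unaffineK eta beta : eta != 0 -> cancel (unaffine eta beta) (affine eta beta).
Proof.
move=> e0 [x|//] /=; rewrite mulrDr mulVKf//; congr Some.
by rewrite mulrN mulrC divfK// subrK.
Qed.

Lemma crd_Some (x : Q2) : exists2 k, abs2 k <= 1 & crd (Some x) = scale k (x, 1).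
Proof.
rewrite /crd; case: (boolP (abs2 x <= 1)) => [x1|].
  by exists 1; rewrite ?abs21// /scale /= !mul1r.
rewrite -ltNge => x1; have x0 : x != 0 by rewrite -abs2_gt0 (lt_trans _ x1).
exists x^-1; last by rewrite /scale /= mulVf// mulr1.
by rewrite abs2V invf_le1 ?abs2_gt0// ltW.
Qed.

Lemma rho_Some_le (x y : Q2) : rho (Some x) (Some y) <= abs2 (x - y).
Proof.
have [k k1 ek] := crd_Some x; have [l l1 el] := crd_Some y.
rewrite /rho ek el; have -> : cross (scale k (x, 1)) (scale l (y, 1)) = k * l * (x - y).
  by rewrite /cross /=; ring.
by rewrite abs2M ler_piMl ?abs2_ge0// abs2_le1_mul.
Qed.

Lemma rho_None_Some (y : Q2) : 1 < abs2 y -> rho None (Some y) = (abs2 y)^-1.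
Proof.
move=> y1; rewrite /rho /crd leNgt y1 /cross /= mul1r mul0r subr0.
exact: abs2V.
Qed.

(* The cells of level k are the classes of the relation d <= 2^-(k+1) for the *)
(* ultrametric d obtained from rho by transport along the affine map h.       *)
Definition cell (eta beta : Q2) (k : nat) (p : P1) : set P1 :=
  [set q | rho (unaffine eta beta p) (unaffine eta beta q) <= 2 ^- k.+1].

Lemma cell_refl eta beta k p : cell eta beta k p p.
Proof. by rewrite /cell /= rho_refl invr_ge0 exprn_ge0. Qed.

Lemma cell_eq eta beta k p q : cell eta beta k p q ->
  cell eta beta k p = cell eta beta k q.
Proof.
rewrite /cell /= => pq; apply/seteqP; split=> r /= hr.
- apply: le_trans (rho_ultra (unaffine eta beta p) _ _) _.
  by rewrite ge_max rho_sym pq.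
- apply: le_trans (rho_ultra (unaffine eta beta q) _ _) _.
  by rewrite ge_max pq.
Qed.

Lemma cell_anti eta beta j k p : (k <= j)%N ->
  cell eta beta j p `<=` cell eta beta k p.
Proof.
move=> kj q; rewrite /cell /= => /le_trans; apply.
by rewrite lef_pV2 ?posrE ?exprn_gt0// ler_eXn2l.
Qed.

Lemma cell_open eta beta k p : eta != 0 -> open (cell eta beta k p : set P1).
Proof.
move=> e0; rewrite openE => q /= /cell_eq ->; rewrite /interior.
have k0 : 0 < 2 ^- k.+1 :> rat by rewrite invr_gt0 exprn_gt0.
case: q => [x|].
  apply/Q2_nbhsP.
  have eta0 : 0 < abs2 eta by rewrite abs2_gt0.
  have [j hj] := pow2_lt (mulr_gt0 k0 eta0).
  exists j => y yx; rewrite /cell /=; apply: le_trans (rho_Some_le _ _) _.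
  rewrite opprD addrACA subrr addr0 -mulrBr abs2M abs2V mulrC.
  rewrite ler_pdivrMr ?abs2_gt0// abs2_distC.
  exact: le_trans yx (ltW hj).
(* Near infinity: the points with |h^-1(x)| <= 2^(k+1) form an affine image of Z_2, which is
   compact, and the cell of infinity contains its complement. *)
pose u := eta / 2 ^+ k.+1.
exists [set u * y + beta | y in Z2].
  split; first exact: compact_affine_Z2.
  by apply: compact_closed; [exact: Q2_hausdorff|exact: compact_affine_Z2].
move=> _ [[x hx <-]|->]; last exact: cell_refl.
rewrite /cell /=.
have T0 : (2 ^+ k.+1 : Q2) != 0 by rewrite expf_neq0 ?Q2_2neq0.
have u0 : u != 0 by rewrite mulf_neq0 ?invr_neq0.
have big : 2 ^+ k.+1 < abs2 (eta^-1 * x + - (beta / eta)).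
  rewrite ltNge; apply/negP => h; apply: hx.
  exists ((x - beta) / u); last by rewrite mulrC divfK// subrK.
  have -> : (x - beta) / u = (eta^-1 * x + - (beta / eta)) * 2 ^+ k.+1.
    by rewrite /u invfM invrK mulrA; congr (_ * _); rewrite mulrBl mulrC.
  rewrite /Z2 /= abs2M abs2X abs2_2 exprVn ler_pdivrMr ?exprn_gt0//.
  by rewrite mul1r.
rewrite rho_None_Some; last by apply: le_lt_trans big; rewrite exprn_ege1.
by rewrite lef_pV2 ?posrE ?exprn_gt0// ?(lt_trans _ big) ?exprn_gt0// ltW.
Qed.

Lemma cell_inter eta beta p q : eta != 0 ->
  (forall k, cell eta beta k p q) -> p = q.
Proof.
move=> e0 h; rewrite -[p](unaffineK beta e0) -[q](unaffineK beta e0).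
congr affine; apply: rho_eq0; apply/le_anti; rewrite abs2_ge0 andbT.
apply/ler_addgt0Pl => e /pow2_lt[N hN]; rewrite addr0.
apply: le_trans (ltW hN); apply: le_trans (h N) _.
by rewrite lef_pV2 ?posrE ?exprn_gt0// ler_eXn2l.
Qed.

(** Otherwise points of the shrinking cells outside [U] would accumulate somewhere, by compactness;
    the limit lies in every cell of [p], so it is [p], which has the neighbourhood [U]. *)
Lemma cell_base eta beta (U : set P1) p : eta != 0 -> open U -> U p ->
  exists k, cell eta beta k p `<=` U.
Proof.
move=> e0 oU Up; apply: contrapT => /forallNP h.
have /choice[q hq] : forall k, exists q, cell eta beta k p q /\ ~ U q.
  by move=> k; have /existsNP[r /not_implyP] := h k; exists r.
have [r [_ cr]] := @one_point_compactification_compact Q2 (q @ \oo) _ filterT.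
have pr : p = r.
  apply: (@cell_inter eta beta) => // k.
  have [s [ps rs]] : cell eta beta k p `&` cell eta beta k r !=set0.
    apply: cr; last by apply: open_nbhs_nbhs; split; [exact: cell_open|exact: cell_refl].
    by exists k => // j /= kj; apply: cell_anti kj _ (hq j).1.
  rewrite (cell_eq ps) -(cell_eq rs); exact: cell_refl.
have [s [ns Us]] : (~` U) `&` U !=set0.
  apply: cr; first by exists 0%N => // j _; exact: (hq j).2.
  by apply: open_nbhs_nbhs; rewrite -pr.
by [].
Qed.

Lemma cell_finite_cover eta beta k : eta != 0 ->
  exists s : nat -> P1, exists n, forall p, exists2 i, (i < n)%N &
    cell eta beta k (s i) p.
Proof.
move=> e0; have := @one_point_compactification_compact Q2.
rewrite compact_cover => /(_ P1 setT (cell eta beta k)) [].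
- by move=> p _; exact: cell_open.
- by move=> p _; exists p => //; exact: cell_refl.
move=> D _ hD; exists (nth None (finmap.enum_fset D)), (size (finmap.enum_fset D)) => p.
have [q /= qD pq] := hD p I.
exists (index q (finmap.enum_fset D)); first by rewrite index_mem.
by rewrite nth_index.
Qed.

Definition cells (eta beta : Q2) : set (set P1) :=
  [set A | A = set0 \/ exists k p, A = cell eta beta k p].

(** Ultrametric balls are nested or disjoint. *)
Lemma cells_setI_closed eta beta : setI_closed (cells eta beta).
Proof.
move=> A A' [->|[k [p ->]]]; first by left; rewrite set0I.
move=> [->|[j [q ->]]]; first by left; rewrite setI0.
have [[r [pr qr]]|/nonemptyPn ->] := pselect (cell eta beta k p `&` cell eta beta j q !=set0);
  last by left.
right; rewrite (cell_eq pr) (cell_eq qr).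
have [kj|jk] := leqP k j.
  by exists j, r; rewrite setIidr//; exact: cell_anti.
by exists k, r; rewrite setIidl//; apply: cell_anti; exact: ltnW.
Qed.

(** Each level has finitely many cells, so an open set is a countable union of those it contains. *)
Lemma open_cells_sigma eta beta (U : set P1) : eta != 0 -> open U ->
  <<s cells eta beta >> U.
Proof.
move=> e0 oU.
have /choice[s hs] : forall k, exists s : nat -> P1, forall p, exists i,
    cell eta beta k (s i) p.
  move=> k; have [s [n hs]] := @cell_finite_cover eta beta k e0.
  by exists s => p; have [i _ hi] := hs p; exists i.
pose F k i := if `[< cell eta beta k (s k i) `<=` U >]
  then cell eta beta k (s k i) else set0.
have -> : U = \bigcup_k \bigcup_i F k i.
  apply/seteqP; split=> [p Up|p [k _ [i _]]]; last first.
    by rewrite /F; case: asboolP => // h; exact: h.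
  have [k hk] := @cell_base eta beta U p e0 oU Up.
  have [i hi] := hs k p.
  exists k => //; exists i => //; rewrite /F asboolT//.
  by rewrite (cell_eq hi).
have FG k i : <<s cells eta beta >> (F k i).
  apply: sub_sigma_algebra; rewrite /F; case: asboolP => _; last by left.
  by right; exists k, (s k i).
apply: sigma_algebra_bigcup => k; exact: sigma_algebra_bigcup.
Qed.

Lemma borel_open (T : ptopologicalType) (U : set T) :
  open U -> measurable (U : set (borel T)).
Proof. by move=> oU; exact: sub_sigma_algebra. Qed.

Lemma borel_closed (T : ptopologicalType) (U : set T) :
  closed U -> measurable (U : set (borel T)).
Proof.
by move=> /closed_openC/borel_open mU; rewrite -[U]setCK; exact: measurableC mU.
Qed.

Lemma cell_measurable eta beta k p : eta != 0 ->
  measurable (cell eta beta k p : set (borel P1)).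
Proof. by move=> e0; apply: (@borel_open P1); exact: cell_open. Qed.

Lemma cell_measure_unique (R : realType) eta beta
    (m1 m2 : {measure set (borel P1) -> \bar R}) :
  eta != 0 -> (m1 setT < +oo)%E ->
  (forall k p, m1 (cell eta beta k p) = m2 (cell eta beta k p)) ->
  forall A : set (borel P1), measurable A -> m1 A = m2 A.
Proof.
move=> e0 m1oo h A mA.
have [s [n hs]] := @cell_finite_cover eta beta 0 e0.
apply: (@g_sigma_algebra_measure_unique _ R (borel P1) (cells eta beta) _
  (fun i => cell eta beta 0 (s i))).
- move=> _ [->|[k [p ->]]]; first exact: measurable0.
  exact: cell_measurable.
- by move=> i; right; exists 0%N, (s i).
- by apply/seteqP; split=> // p _; have [i _ hi] := hs p; exists i.
- exact: cells_setI_closed.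
- by move=> _ [->|[k [p ->]]]; rewrite ?measure0.
- move=> k; apply: le_lt_trans m1oo; apply: le_measure; rewrite ?inE//.
  exact: cell_measurable.
- move: A mA; apply: smallest_sub => [|U oU]; last exact: open_cells_sigma.
  exact: smallest_sigma_algebra.
Qed.

Lemma cell_continuous eta beta (g : Q2 -> P1) : eta != 0 ->
  (forall x y, rho (unaffine eta beta (g x)) (unaffine eta beta (g y)) <=
    abs2 (x - y)) -> continuous g.
Proof.
move=> e0 hg x U; rewrite nbhsE => -[V [oV Vx] VU].
have [k hk] := @cell_base eta beta V (g x) e0 oV Vx.
apply/Q2_nbhsP; exists k.+1 => y yx; apply/VU/hk.
by rewrite /cell /=; apply: le_trans (hg _ _) _; rewrite abs2_distC.
Qed.

Lemma continuous_borel (T T' : ptopologicalType) (g : T -> T') : continuous g ->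
  measurable_fun setT (g : borel T -> borel T').
Proof.
move=> /continuousP cg; apply: (@measurability _ _ (borel T) (borel T') setT g (@open T')) => //.
move=> _ [U oU <-]; rewrite setTI; apply: borel_open; exact: cg.
Qed.

(** * The inversion [xi], Haar measure of balls, and [mu_hat] *)

Lemma xi_mobius p : xi p = mobius 0 1 1 0 p.
Proof.
case: p => [x|] /=; last by rewrite oner_eq0 mul0r.
by rewrite mul1r mul0r addr0 add0r mul1r.
Qed.

Lemma rho_xi p q : rho (xi p) (xi q) = rho p q.
Proof.
by rewrite !xi_mobius rho_mobius ?abs20 ?abs21// mulr0 mulr1 sub0r abs2N abs21.
Qed.

Lemma crd_xi (w : Q2) : abs2 w < 1 -> crd (xi (Some w)) = (1, w).
Proof.
move=> w1 /=; case: eqVneq => [->//|w0] /=.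
by rewrite abs2V leNgt invf_gt1 ?abs2_gt0// w1 invrK.
Qed.

Lemma xi_notin_Z2 (w : Q2) : (~ (Some @` Z2) (xi (Some w))) <-> abs2 w < 1.
Proof.
rewrite /=; case: eqVneq => [->|w0]; first by rewrite abs20; split=> // _ [].
rewrite ltNge; split=> [h|/negP h [x x1 [xw]]].
  apply/negP => w1; apply: h; exists w^-1 => //.
  by rewrite /Z2 /= abs2V invf_le1 ?abs2_gt0.
apply: h; move: x1; rewrite xw /Z2 /= abs2V invf_le1 ?abs2_gt0//.
Qed.

Lemma notin_Z2_xi (q : P1) : ~ (Some @` Z2) q ->
  exists2 w, abs2 w < 1 & q = xi (Some w).
Proof.
case: q => [x|] h; last by exists 0; rewrite ?abs20//= eqxx.
have x1 : 1 < abs2 x by rewrite ltNge; apply/negP => x1; apply: h; exists x.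
have x0 : x != 0 by rewrite -abs2_gt0 (lt_trans _ x1).
exists x^-1; first by rewrite abs2V invf_lt1 ?abs2_gt0.
by rewrite /= invr_eq0 (negbTE x0) invrK.
Qed.

Lemma rho_Z2 (x y : Q2) : Z2 x -> Z2 y -> rho (Some x) (Some y) = abs2 (x - y).
Proof. by rewrite /Z2 /rho /cross /= => -> ->; rewrite mulr1 mul1r. Qed.

Lemma rho_Z2_xi (x w : Q2) : Z2 x -> abs2 w < 1 -> rho (Some x) (xi (Some w)) = 1.
Proof.
rewrite /Z2 /= => x1 w1; rewrite /rho crd_xi// /crd x1 /cross /= mul1r.
by rewrite addrC abs2_addl abs2N abs21// abs2_lt1_mulr.
Qed.

Lemma Q2_ball_open (a : Q2) k : open [set x : Q2 | abs2 (x - a) <= 2 ^- k].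
Proof.
rewrite openE => x /= xa; apply/Q2_nbhsP; exists k => y yx /=.
by rewrite -(subrKA x) abs2_le_add.
Qed.

Lemma haar_ball (R : realType) (mu0 : probability (borel Q2) R) k (a : Q2) :
  haar_probability_Z2 mu0 -> Z2 a ->
  mu0 [set x : Q2 | abs2 (x - a) <= 2 ^- k] = (2 ^- k)%:E.
Proof.
move=> [muZ tr] Za.
pose b k (a : Q2) : set Q2 := [set x | abs2 (x - a) <= 2 ^- k].
have mb j c : measurable (b j c : set (borel Q2)) by apply: (@borel_open Q2); exact: Q2_ball_open.
have le1 j : 2 ^- j <= 1 :> rat by rewrite invf_le1 ?exprn_gt0// exprn_ege1.
have trans j c : Z2 c -> mu0 (b j c) = mu0 (b j 0).
  move=> Zc; rewrite -(tr c _ Zc (mb j 0)).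
    congr (mu0 _); apply/seteqP; split=> [x|_ [x /= + <-]]; rewrite /b /=.
      by move=> xc; exists (x - c); rewrite ?subr0// addrC subrK.
    by rewrite subr0 (addrC c) addrK.
  by move=> x; rewrite /b /Z2 /= subr0 => /le_trans; apply.
rewrite -/(b k a) trans// => {a Za}.
elim: k => [|k IH].
  rewrite expr0 invr1 -muZ; congr (mu0 _).
  by apply/seteqP; split=> x; rewrite /b /Z2 /= subr0 ?expr0 ?invr1.
have T : abs2 (2 ^+ k : Q2) = 2 ^- k by rewrite abs2X abs2_2 exprVn.
have T0 : (2 ^+ k : Q2) != 0 by rewrite expf_neq0 ?Q2_2neq0.
have Z2k : Z2 (2 ^+ k) by rewrite /Z2 /= T.
(* A ball is the disjoint union of two translates of the ball of half the radius, so the mass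
   halves. *)
have split : b k 0 = b k.+1 0 `|` b k.+1 (2 ^+ k).
  apply/seteqP; split=> x; rewrite /b /= subr0 -!abs2_lt_halfn.
    move=> hx; have [h|h] := ltP (abs2 x) (2 ^- k); [by left|right].
    have e : abs2 x = 2 ^- k by apply/le_anti; rewrite hx.
    have : abs2 (x / 2 ^+ k) = 1 by rewrite abs2M abs2V T e divff// invr_neq0// expf_neq0.
    move=> /abs2_unit_sub1.
    have -> : x / 2 ^+ k - 1 = (x - 2 ^+ k) / 2 ^+ k by rewrite [RHS]mulrBl divff.
    by rewrite abs2M abs2V T ltr_pdivrMr ?invr_gt0 ?exprn_gt0// mul1r.
  move=> [/ltW//|/ltW h].
  by rewrite -(subrK (2 ^+ k) x) abs2_le_add// T.
have disj : b k.+1 0 `&` b k.+1 (2 ^+ k) = set0.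
  apply/seteqP; split=> // x; rewrite /b /= subr0 -!abs2_lt_halfn => -[h1 h2].
  have := abs2_lt_sub h1 h2.
  by rewrite opprB addrC subrK T ltxx.
have tk := trans k.+1 _ Z2k.
have e : mu0 (b k 0) = (mu0 (b k.+1 0%R) + mu0 (b k.+1 0%R))%E.
  by rewrite split -{2}tk; exact: (measureU mu0 (mb _ _) (mb _ _) disj).
move: e; rewrite IH.
have : (mu0 (b k.+1 0) \is a fin_num) by exact: fin_num_measure.
case: (mu0 _) => [r| |] // _; rewrite -EFinD => -[h]; congr EFin.
by rewrite exprS invfM h; lra.
Qed.

(** It is 2/3 times the sum of the images of [mu0] restricted to Z_2 under h and of [mu0] restricted
    to 2 Z_2 under h o xi. *)
Lemma mu_hat_measure (R : realType) (mu0 : probability (borel Q2) R) eta beta :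
  eta != 0 -> exists nu : {measure set (borel P1) -> \bar R},
  (nu setT < +oo)%E /\ forall A : set P1, nu A = mu_hat mu0 (affine eta beta @^-1` A).
Proof.
move=> e0; pose h := affine eta beta.
have c1 : continuous (h \o Some : Q2 -> P1).
  apply: (@cell_continuous eta beta) => // x y.
  have e z : unaffine eta beta ((h \o Some) z) = Some z := affineK beta e0 (Some z).
  by rewrite !e; exact: rho_Some_le.
have c2 : continuous (h \o xi \o Some : Q2 -> P1).
  apply: (@cell_continuous eta beta) => // x y.
  have e z : unaffine eta beta ((h \o xi \o Some) z) = xi (Some z) :=
    affineK beta e0 (xi (Some z)).
  by rewrite !e rho_xi; exact: rho_Some_le.
have mZ : measurable (Z2 : set (borel Q2)).
  have -> : Z2 = [set x : Q2 | abs2 (x - 0) <= 2 ^- 0].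
    by apply/seteqP; split=> x; rewrite /Z2 /= subr0 expr0 invr1.
  by apply: (@borel_open Q2); exact: Q2_ball_open.
pose D : set Q2 := [set w | ~ (Some @` Z2) (xi (Some w))].
have mD : measurable (D : set (borel Q2)).
  have -> : D = [set x : Q2 | abs2 (x - 0) <= 2 ^- 1].
    by apply/seteqP; split=> x; rewrite /D /= subr0 expr1 -abs2_lt1 => /xi_notin_Z2.
  by apply: (@borel_open Q2); exact: Q2_ball_open.
unshelve epose (m1 := (pushforward (mrestr mu0 mZ) (h \o Some : borel Q2 -> borel P1)
   : {measure set (borel P1) -> \bar R})).
  exact: continuous_borel c1.
unshelve epose (m2 := (pushforward (mrestr mu0 mD) (h \o xi \o Some : borel Q2 -> borel P1)
   : {measure set (borel P1) -> \bar R})).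
  exact: continuous_borel c2.
exists (mscale (2 / 3)%:nng (measure_add m1 m2)); split=> [|A].
  rewrite -[X in (X < _)%E]/((2 / 3)%:E * measure_add m1 m2 setT)%E measure_addE.
  apply: lte_mul_pinfty => //.
  have e1 : m1 setT = mu0 (setT `&` Z2) by [].
  have e2 : m2 setT = mu0 (setT `&` D) by [].
  by rewrite e1 e2 !setTI lte_add_pinfty// -ge0_fin_numE//; exact: fin_num_measure.
transitivity ((2 / 3)%:E * measure_add m1 m2 A)%E; first by [].
rewrite measure_addE /mu_hat; congr (_ * (_ + _))%E.
  by rewrite /m1 /pushforward /mrestr setIC.
by rewrite /m2 /pushforward /mrestr setIC.
Qed.

(** A ball of radius at most 1/2 lies entirely in Z_2 or in its complement, points of the two being
    at distance 1. In the second case the isometry [xi] carries it to a ball in 2 Z_2. *)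
Lemma mu_hat_cell (R : realType) (mu0 : probability (borel Q2) R) eta beta k p :
  haar_probability_Z2 mu0 -> eta != 0 ->
  mu_hat mu0 (affine eta beta @^-1` cell eta beta k p) = (2 / 3 * 2 ^- k.+1)%:E.
Proof.
move=> hmu e0.
have -> : affine eta beta @^-1` cell eta beta k p =
    [set q | rho (unaffine eta beta p) q <= 2 ^- k.+1].
  by apply/seteqP; split=> q; rewrite /cell /= affineK.
move: (unaffine eta beta p) => u {p}.
have k1 : 2 ^- k.+1 < 1 :> rat by rewrite invf_lt1 ?exprn_gt0// exprn_egt1.
rewrite /mu_hat; have [[z Zz <-]|] := pselect ((Some @` Z2) u).
  rewrite [X in (_ + X)%E](_ : _ = 0%E); last first.
    rewrite -(measure0 mu0); congr (mu0 _); apply/seteqP; split=> // w /=.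
    move=> [/xi_notin_Z2 w1]; rewrite rho_Z2_xi// leNgt k1.
    by [].
  rewrite adde0 [X in (_ * X)%E](_ : _ = (2 ^- k.+1)%:E) ?EFinM//.
  rewrite -(haar_ball k.+1 hmu Zz); congr (mu0 _); apply/seteqP; split=> x /=.
    by move=> [Zx]; rewrite rho_Z2// abs2_distC.
  move=> xz; have Zx : Z2 x.
    by rewrite /Z2 /= -(subrK z x) abs2_le_add// (le_trans xz)// ltW.
  by split=> //; rewrite rho_Z2// abs2_distC.
move=> /notin_Z2_xi[w w1 ->].
rewrite [X in (X + _)%E](_ : _ = 0%E); last first.
  rewrite -(measure0 mu0); congr (mu0 _); apply/seteqP; split=> // x /=.
  move=> [Zx]; rewrite rho_sym rho_Z2_xi// leNgt k1.
  by [].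
rewrite add0e [X in (_ * X)%E](_ : _ = (2 ^- k.+1)%:E) ?EFinM//.
have e x : abs2 x < 1 -> rho (xi (Some w)) (xi (Some x)) = abs2 (x - w).
  by move=> x1; rewrite rho_xi rho_Z2; [exact: abs2_distC|exact: ltW w1|exact: ltW x1].
rewrite -(haar_ball k.+1 hmu (ltW w1)); congr (mu0 _).
apply/seteqP; split=> [x [/xi_notin_Z2 x1 hx]|x xw].
  have {hx} : rho (xi (Some w)) (xi (Some x)) <= 2 ^- k.+1 := hx.
  by rewrite e.
have x1 : abs2 x < 1.
  by rewrite -(subrK w x) abs2_lt_add// (le_lt_trans xw).
split; first exact/xi_notin_Z2.
by suff : rho (xi (Some w)) (xi (Some x)) <= 2 ^- k.+1 by []; rewrite e.
Qed.

(** * Isometries and the invariant measure of a minimal set *)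

Lemma isometry_continuous eta beta (f : P1 -> P1) : eta != 0 ->
  (forall k p q, cell eta beta k (f p) (f q) <-> cell eta beta k p q) ->
  continuous f.
Proof.
move=> e0 hf x U; rewrite nbhsE => -[V [oV Vx] VU].
have [k hk] := @cell_base eta beta V (f x) e0 oV Vx.
have nc : nbhs x (cell eta beta k x).
  by apply: open_nbhs_nbhs; split; [exact: cell_open|exact: cell_refl].
by apply: filterS nc => y hy; apply/VU/hk/hf.
Qed.

(** The preimage of a cell is a cell of the same level, so [nu] and its image agree on the
    generating pi-system. *)
Lemma isometry_preserves (R : realType) eta beta (f : P1 -> P1)
    (nu : {measure set (borel P1) -> \bar R}) (w : nat -> R) : eta != 0 ->
  (forall k p q, cell eta beta k (f p) (f q) <-> cell eta beta k p q) ->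
  (forall q, exists p, f p = q) ->
  (forall k p, nu (cell eta beta k p) = (w k)%:E) -> (nu setT < +oo)%E ->
  forall A : set (borel P1), measurable A -> nu (f @^-1` A) = nu A.
Proof.
move=> e0 hf sf hw nuoo A mA.
have mf := continuous_borel (isometry_continuous e0 hf).
unshelve epose (m2 := (pushforward nu (f : borel P1 -> borel P1)
   : {measure set (borel P1) -> \bar R})); first exact: mf.
have h k q : nu (cell eta beta k q) = m2 (cell eta beta k q).
  have [p <-] := sf q; rewrite hw -(hw k p).
  have -> : cell eta beta k p = f @^-1` cell eta beta k (f p).
    by apply/seteqP; split=> r; [exact: (hf k p r).2|exact: (hf k p r).1].
  by [].
have -> : nu (f @^-1` A) = m2 A by [].
exact/esym/(@cell_measure_unique R eta beta nu m2 e0 nuoo h A mA).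
Qed.

(** Invariance gives the cells along an orbit in [B] the same mass, and by minimality the orbit of
    [p] enters the cell of [q]. *)
Lemma invariant_cell (R : realType) eta beta f B (tau : probability (borel P1) R) :
  eta != 0 ->
  (forall k p q, cell eta beta k (f p) (f q) <-> cell eta beta k p q) ->
  measurable (B : set (borel P1)) ->
  minimal_subsystem f B -> invariant_probability f B tau ->
  forall k p q, B p -> B q ->
  tau (cell eta beta k p) = tau (cell eta beta k q).
Proof.
move=> e0 hf mB [[_ _ fB] orb] [tB tinv] k p q Bp Bq.
have mc r : measurable (cell eta beta k r : set (borel P1)) by exact: cell_measurable.
have BfB : B `<=` f @^-1` B by move=> r Br; apply: fB; exists r.
have tIB A : measurable (A : set (borel P1)) -> tau (A `&` B) = tau A.
  move=> mA; have t0 : tau (~` B) = 0%E by rewrite probability_setC// tB subee.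
  rewrite [RHS](measureDI _ mA mB) [X in _ = (X + _)%E](_ : _ = 0%E) ?add0e//.
  apply: subset_measure0 t0 => //.
  - exact: measurableD.
  - exact: measurableC.
have step r : B r -> tau (cell eta beta k (f r)) = tau (cell eta beta k r).
  move=> Br; rewrite -tIB// -tinv; [|exact: measurableI|by move=> ? []].
  rewrite -[RHS]tIB//; congr (tau _); apply/seteqP; split=> s /=.
    by move=> [Bs [/hf cs _]].
  by move=> [cs Bs]; split=> //; split; [exact/hf|exact: BfB].
have iterB i : B (iter i f p).
  by elim: i => //= i IH; exact: BfB.
have iterE i : tau (cell eta beta k (iter i f p)) = tau (cell eta beta k p).
  by elim: i => //= i <-; exact: step.
have : closure [set iter n f p | n in [set: nat]] q by rewrite -orb.
move=> /(_ (cell eta beta k q)) [].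
  by apply: open_nbhs_nbhs; split; [exact: cell_open|exact: cell_refl].
by move=> _ [[i _ <-] qi]; rewrite (cell_eq qi) iterE.
Qed.

Lemma invariant_probability_unique (R : realType) eta beta f B
    (tau sigma : probability (borel P1) R) :
  eta != 0 ->
  (forall k p q, cell eta beta k (f p) (f q) <-> cell eta beta k p q) ->
  measurable (B : set (borel P1)) -> minimal_subsystem f B ->
  invariant_probability f B tau -> invariant_probability f B sigma ->
  forall A : set (borel P1), measurable A -> tau A = sigma A.
Proof.
move=> e0 hf mB minB itau isig.
apply: (@cell_measure_unique R eta beta) => // [|k].
  by have := ltry (1 : R); rewrite -(probability_setT tau).
have mc r : measurable (cell eta beta k r : set (borel P1)) by exact: cell_measurable.
have [p0 Bp0] : B !=set0 by case: minB => -[].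
have null (m : probability (borel P1) R) p : m B = 1%E ->
    ~ (cell eta beta k p `&` B !=set0) -> m (cell eta beta k p) = 0%E.
  move=> mB1 h; have t0 : m (~` B) = 0%E by rewrite probability_setC// mB1 subee.
  apply: subset_measure0 t0 => //; first exact: measurableC.
  by move=> q cq Bq; apply: h; exists q.
have [tB _] := itau; have [sB _] := isig.
(* On cells of level k both measures are constant on those meeting [B] and vanish on the rest, hence
   are proportional. Adding this over a finite partition of the space compares the constants. *)
have prop p : (sigma (cell eta beta k p0) * tau (cell eta beta k p) =
    tau (cell eta beta k p0) * sigma (cell eta beta k p))%E.
  have [[q [cq Bq]]|h] := pselect (cell eta beta k p `&` B !=set0).
    rewrite (cell_eq cq) (invariant_cell e0 hf mB minB itau k Bq Bp0).
    by rewrite (invariant_cell e0 hf mB minB isig k Bq Bp0) muleC.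
  by rewrite (null _ _ tB h) (null _ _ sB h) !mule0.
suff e : tau (cell eta beta k p0) = sigma (cell eta beta k p0).
  move=> p; have [[q [cq Bq]]|h] := pselect (cell eta beta k p `&` B !=set0).
    have ht := invariant_cell e0 hf mB minB itau k Bq Bp0.
    have hs := invariant_cell e0 hf mB minB isig k Bq Bp0.
    by rewrite (cell_eq cq); exact: (etrans ht (etrans e (esym hs))).
  exact: (etrans (null _ _ tB h) (esym (null _ _ sB h))).
have [s [n hs]] := @cell_finite_cover eta beta k e0.
pose U j := [set p | exists2 i, (i < j)%N & cell eta beta k (s i) p].
have US j : U j.+1 = U j `|` cell eta beta k (s j).
  apply/seteqP; split=> p.
    move=> [i]; rewrite ltnS leq_eqVlt => /predU1P[->|ij] hi; first by right.
    by left; exists i.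
  move=> [[i ij hi]|hj]; last by exists j.
  by exists i => //; rewrite ltnS ltnW.
have U0 : U 0%N = set0 by apply/seteqP; split=> // p [].
have mU j : measurable (U j : set (borel P1)).
  elim: j => [|j IH]; first by rewrite U0.
  by rewrite US; exact: measurableU.
have propU j : (sigma (cell eta beta k p0) * tau (U j) =
    tau (cell eta beta k p0) * sigma (U j))%E.
  elim: j => [|j IH]; first by rewrite U0 !measure0 !mule0.
  (* A cell of the cover is either one of those already counted or disjoint from all of them. *)
  have [[q [[i ij iq] jq]]|/nonemptyPn dj] :=
    pselect (U j `&` cell eta beta k (s j) !=set0).
    rewrite US (_ : U j `|` _ = U j)//; apply/setUidPl => r jr.
    by exists i => //; rewrite (cell_eq iq) -(cell_eq jq).
  by rewrite US !measureU// !ge0_muleDr// IH prop.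
have UT : U n = [set: borel P1].
  by apply/seteqP; split=> // p _; exact: hs.
by have := propU n; rewrite UT !probability_setT !mule1.
Qed.

Lemma mnormalizeE (d : measure_display) (T : measurableType d) (R : realType)
    (m : {measure set T -> \bar R}) (P : probability T R) (A : set T) :
  m setT != 0%E -> m setT \is a fin_num ->
  mnormalize m P A = (m A / m setT)%E.
Proof.
rewrite /mnormalize; case: (m setT) => [r| |]//=; rewrite !eqe => r0 _.
by rewrite inver (negbTE r0).
Qed.

(** Here [nu] stands for mu_hat o h^-1; only its equal masses on cells of one level and the local
    density of orbits matter. *)
Lemma minimal_subsystem_measure (R : realType) eta beta f B
    (nu : {measure set (borel P1) -> \bar R}) (w : nat -> R) : eta != 0 ->
  (forall k p q, cell eta beta k (f p) (f q) <-> cell eta beta k p q) ->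
  (forall q, exists p, f p = q) ->
  (forall k p, nu (cell eta beta k p) = (w k)%:E) -> (forall k, 0 < w k) ->
  (nu setT < +oo)%E ->
  (exists m, forall p q k, cell eta beta m p q ->
    exists i, cell eta beta k (iter i f p) q) ->
  minimal_subsystem f B ->
  exists sigma : probability (borel P1) R,
    [/\ invariant_probability f B sigma,
        forall A : set (borel P1), measurable A -> A `<=` B ->
          sigma A = (nu A / nu B)%E &
        forall tau : probability (borel P1) R,
          invariant_probability f B tau ->
          forall A : set (borel P1), measurable A -> A `<=` B ->
            tau A = sigma A].
Proof.
move=> e0 hf sf hw w0 nuoo [m dense] minB.
have [[[p0 Bp0] cB fB] orb] := minB.
have clB : closed B by rewrite (orb _ Bp0); exact: closed_closure.
have mB : measurable (B : set (borel P1)) by exact: (@borel_closed P1).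
have BfB : B `<=` f @^-1` B by move=> r Br; apply: fB; exists r.
have mf := continuous_borel (isometry_continuous e0 hf).
have mpre (A : set (borel P1)) : measurable A -> measurable (f @^-1` A : set (borel P1)).
  by move=> mA; rewrite -[X in measurable X]setTI; exact: mf.
have inv (A : set (borel P1)) : measurable A -> nu (f @^-1` A) = nu A.
  exact: isometry_preserves e0 hf sf hw nuoo A.
have fin (A : set (borel P1)) : measurable A -> nu A \is a fin_num.
  move=> mA; rewrite ge0_fin_numE//; apply: le_lt_trans nuoo.
  by apply: le_measure; rewrite ?inE.
have nuB0 : nu B != 0%E.
  (* The orbit of [p0] is dense in its cell of level [m], and [B] is the closure of that orbit. *)
  have cB' : cell eta beta m p0 `<=` B.
    move=> q cq; rewrite (orb _ Bp0) => V /= ; rewrite nbhsE => -[W [oW Wq] WV].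
    have [k hk] := @cell_base eta beta W q e0 oW Wq.
    have [i hi] := dense _ _ k cq.
    exists (iter i f p0); split; first by exists i.
    by apply/WV/hk; rewrite -(cell_eq hi); exact: cell_refl.
  apply/negP => /eqP nuB0.
  have : (nu (cell eta beta m p0) <= nu B)%E.
    by apply: le_measure; rewrite ?inE//; exact: cell_measurable.
  by rewrite hw nuB0 lee_fin leNgt w0.
(* The Dirac mass is the default of [mnormalize] for total mass 0 or infinity; here the total mass
   is [nu B], positive and finite. *)
pose sigma : probability (borel P1) R :=
  mnormalize (mrestr nu mB) \d_(None : borel P1).
have sE A : sigma A = (nu (A `&` B) / nu B)%E.
  have eT : mrestr nu mB setT = nu B by rewrite /mrestr setTI.
  transitivity (mrestr nu mB A / mrestr nu mB setT)%E; last by rewrite eT.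
  by apply: mnormalizeE; [have := nuB0|have := fin _ mB]; rewrite -eT.
have Binv (A : set (borel P1)) : measurable A -> A `<=` B ->
    nu (B `&` f @^-1` A) = nu A.
  move=> mA AB; rewrite -(inv A mA) [RHS](measureDI _ (mpre _ mA) mB).
  rewrite [X in _ = (X + _)%E](_ : _ = 0%E) ?add0e 1?setIC//.
  (* [B] lies in its preimage, which has the same finite mass. *)
  have z : nu (f @^-1` B `\` B) = 0%E.
    have e := measureDI nu (mpre _ mB) mB; rewrite (setIidr BfB) in e.
    have {}e : nu B = (nu (f @^-1` B `\` B) + nu B)%E := etrans (esym (inv B mB)) e.
    move: e; have := fin _ mB; have := fin _ (measurableD (mpre _ mB) mB).
    case: (nu (_ `\` _)) => [x| |]//; case: (nu B) => [y| |]// _ _.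
    rewrite -EFinD => -[h]; congr EFin.
    by apply: (@addIr _ y); rewrite -h add0r.
  apply: subset_measure0 z => //.
  - exact: measurableD (mpre _ mA) mB.
  - exact: measurableD (mpre _ mB) mB.
  - by move=> r [Ar nBr]; split=> //; exact: AB.
have isig : invariant_probability f B sigma.
  split=> [|A mA AB].
    rewrite sE setIid; have := fin _ mB; move: nuB0.
    case: (nu B) => [r| |]//; rewrite eqe => r0 _.
    by rewrite inver (negbTE r0) -EFinM divff.
  by rewrite !sE (setIidl AB) setIAC setIid Binv.
exists sigma; split=> // [A mA AB|tau itau A mA AB].
  by rewrite sE (setIidl AB).
exact: (invariant_probability_unique e0 hf mB minB itau isig).
Qed.

(** * The quadratic extension and the conjugation by h *)

Lemma floor_v2 (R : realType) (L : fieldExtType Q2) (absL : L -> R) (s : L)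
    (k : int) : absL s = ratr (2 ^ (- k)) -> Num.floor (v2 absL s) = k.
Proof.
have ln20 : ln 2 != 0 :> R by rewrite gt_eqF// ln_gt0// ltr1n.
move=> e; suff -> : v2 absL s = k%:~R by rewrite intrKfloor.
rewrite /v2 e; have -> : ratr (2 ^ (- k)) = 2 ^ (- k) :> R.
  by rewrite fmorphXz rmorph_nat.
have -> : ln (2 ^ (- k)) = - (k%:~R * ln 2) :> R.
  case: k {e} => n.
    by rewrite -exprnN lnV ?posrE ?exprn_gt0// lnXn// -pmulrn mulr_natl.
  by rewrite NegzE opprK -exprnP lnXn// mulrNz mulNr opprK -pmulrn mulr_natl.
by rewrite mulNr opprK mulfK.
Qed.

Lemma mem_adjoin_quadratic (F : fieldType) (L : fieldExtType F) (t : L) (r : F) (x : L) :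
  t ^+ 2 = r%:A -> x \in <<1%VS; t>>%VS -> exists u w : F, x = u%:A + w%:A * t.
Proof.
move=> tt /Fadjoin_polyP[p /polyOverP hp ->].
rewrite horner_coef; apply: (big_ind (fun y => exists u w : F, y = u%:A + w%:A * t)).
- by exists 0, 0; rewrite scale0r mul0r addr0.
- move=> _ _ [u [w ->]] [u' [w' ->]]; exists (u + u'), (w + w').
  by rewrite !scalerDl mulrDl addrACA.
move=> i _; have /vlineP[k ->] := hp i.
have [u [w ->]] : exists u w : F, t ^+ i = u%:A + w%:A * t.
  elim: (i : nat) => [|j [u [w IH]]].
    by exists 1, 0; rewrite scale1r scale0r mul0r addr0.
  exists (w * r), u; rewrite exprSr IH mulrDl -mulrA -expr2 tt.
  by rewrite -!in_algE -rmorphM addrC.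
by exists (k * u), (k * w); rewrite mulrDr !mulrA -!in_algE -!rmorphM.
Qed.

Lemma in_alg_mem1 (F : fieldType) (L : fieldExtType F) (k : F) : k%:A \in (1%VS : {vspace L}).
Proof. by rewrite rpredZ// mem1v. Qed.

Lemma sqr_add_mul (F L : comNzRingType) (i : {rmorphism F -> L}) (u w r : F) (t : L) :
  t ^+ 2 = i r ->
  (i u + i w * t) ^+ 2 = i (u ^+ 2 + r * w ^+ 2) + i (2 * u * w) * t.
Proof.
move=> h; transitivity (i u ^+ 2 + i w ^+ 2 * t ^+ 2 + 2 * i u * i w * t).
  by ring.
by rewrite h; ring.
Qed.

(** Write s = u + w t and square: if u were nonzero, 2 u w t and hence s would lie in [F]. *)
Lemma adjoin_sqrt_mul (F : fieldType) (L : fieldExtType F) (s t : L) (D r : F) :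
  (2 : F) != 0 ->
  s ^+ 2 = D%:A -> s \notin 1%VS -> t ^+ 2 = r%:A ->
  <<1%VS; s>>%VS = <<1%VS; t>>%VS ->
  exists w : F, [/\ w != 0, s = w%:A * t & D = r * w ^+ 2].
Proof.
move=> two0 hs s1 ht e.
have [u [w es]] : exists u w : F, s = u%:A + w%:A * t.
  by apply: mem_adjoin_quadratic ht _; rewrite -e memv_adjoin.
have w0 : w != 0.
  by apply: contraNneq s1 => w0; rewrite es w0 scale0r mul0r addr0 in_alg_mem1.
have hs2 : D%:A = (u ^+ 2 + r * w ^+ 2)%:A + (2 * u * w)%:A * t.
  by rewrite -hs es -!in_algE; exact: sqr_add_mul.
have u0 : u = 0.
  apply/eqP/negPn/negP => u0; move/negP: s1; apply.
  have k0 : 2 * u * w != 0 by rewrite !mulf_neq0.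
  have -> : s = u%:A + w%:A * ((D - (u ^+ 2 + r * w ^+ 2)) / (2 * u * w))%:A.
    rewrite es; congr (_ + _ * _); rewrite -!in_algE fmorph_div rmorphB /=.
    by rewrite hs2 addrC addKr mulrC mulKf// -in_algE fmorph_eq0.
  by rewrite rpredD ?rpredM ?in_alg_mem1.
exists w; split=> //; first by rewrite es u0 scale0r add0r.
apply: (fmorph_inj (in_alg L)); rewrite -[LHS]/(D%:A) hs2 u0.
by rewrite mulr0 mul0r scale0r mul0r addr0 expr0n add0r.
Qed.

Lemma mobius_surjective a b c d q : a * d - b * c != 0 ->
  exists p, mobius a b c d p = q.
Proof.
move=> D0; exists (mobius d (- b) (- c) a q).
rewrite mobius_comp; last first.
  by have -> : d * a - - b * - c = a * d - b * c by ring.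
rewrite -[RHS]mobius_id -(mobius_scale 1 0 0 1 q D0); congr mobius; ring.
Qed.

(** With u = 1 + 2 q the quotient is 1 + 3 q (q + 1), and q (q + 1) is even. *)
Lemma unit_square (u : Q2) : abs2 u = 1 -> abs2 ((3 * u ^+ 2 + 1) / 4) = 1.
Proof.
move=> u1; pose q := (u - 1) / 2.
have q1 : abs2 q <= 1 by rewrite -abs2_lt1E abs2_unit_sub1.
have eu : u = 1 + 2 * q by rewrite mulrC divfK ?Q2_2neq0// addrC subrK.
have four0 : (4 : Q2) != 0 by rewrite -abs2_eq0E abs2_nat.
have -> : (3 * u ^+ 2 + 1) / 4 = 1 + 3 * (q * (q + 1)).
  apply: (mulIf four0); rewrite divfK// eu; ring.
rewrite abs2_addl abs21// abs2_lt1_mulr//; first by rewrite abs2_nat.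
have [hq|hq] := ltP (abs2 q) 1.
  by rewrite mulrC abs2_lt1_mulr// abs2_le_add ?abs21.
by rewrite abs2_lt1_mulr// abs2_unit_add ?abs21//; apply/le_anti; rewrite q1.
Qed.

(** Sending N to a root [th] of X^2 = X + n is multiplicative. *)
Lemma ev_psix (L : comNzRingType) (i : {rmorphism Q2 -> L}) (n : Q2) (th : L) z :
  th ^+ 2 = th + i n ->
  i (psix n z).1 + i (psix n z).2 * th = (i z.1 + i z.2 * th) ^+ 6.
Proof.
move=> hth; pose ev z : L := i z.1 + i z.2 * th.
have evM u v : ev (pmul n u v) = ev u * ev v.
  rewrite /ev /pmul /= !rmorphD !rmorphM.
  transitivity (i u.1 * i v.1 + (i u.1 * i v.2 + i u.2 * i v.1) * th +
    i u.2 * i v.2 * (th + i n)); first by ring.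
  by rewrite -hth; ring.
rewrite -[LHS]/(ev (psix n z)) -[X in X ^+ 6]/(ev z).
by rewrite /psix /pcube !evM; ring.
Qed.

(** The equations compare the entries of h^-1 M h with those of k (x + y N). *)
Lemma mobius_conj a b c d eta beta n1 n2 z k p :
  abs2 n1 = 1 -> abs2 n2 = 1 -> primitive z -> k != 0 -> eta != 0 ->
  k * z.1 = c * beta + d -> k * (z.2 * n2) = c * eta ->
  k * (z.1 + z.2) = a - beta * c ->
  eta * (k * (z.2 * n1)) = b + (a - d) * beta - c * beta ^+ 2 ->
  mobius a b c d (affine eta beta p) = affine eta beta (mobN n1 n2 z p).
Proof.
move=> n11 n21 pz k0 e0 e1 e2 e3 e4; rewrite !affine_mobius /mobN.
rewrite mobius_comp; last by rewrite mulr1 mulr0 subr0.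
rewrite mobius_comp; last exact/abs2_unit_neq0/mobN_det.
rewrite -[RHS](mobius_scale _ _ _ _ _ k0); congr mobius.
- transitivity (eta * (k * (z.1 + z.2)) + beta * (k * (z.2 * n2))); last by ring.
  by rewrite e3 e2; ring.
- transitivity (eta * (k * (z.2 * n1)) + beta * (k * z.1)); last by ring.
  by rewrite e4 e1; ring.
- transitivity (k * (z.2 * n2)); last by ring.
  by rewrite e2; ring.
- transitivity (k * z.1); last by ring.
  by rewrite e1; ring.
Qed.

(** The factors are n1 and n2, so their product is - det N; the eigenvalues (1 +- sqrt Delta / T) /
    2 of N have product (1 - Delta / T^2) / 4. *)
Lemma conj_norm (F : fieldType) (a b c d eta w T : F) :
  (2 : F) != 0 -> c != 0 -> eta != 0 -> T != 0 ->
  (d - a) ^+ 2 + 4 * b * c = - 3 * w ^+ 2 ->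
  let beta := (a - d - T) / (2 * c) in
  (b + (a - d) * beta - c * beta ^+ 2) / (eta * T) * (c * eta / T) =
  - ((3 * (w / T) ^+ 2 + 1) / 4).
Proof.
move=> two0 c0 e0 T0 h beta.
have four0 : (4 : F) != 0 by rewrite (_ : 4 = 2 * 2) ?mulf_neq0//; ring.
have eb : b = (- 3 * w ^+ 2 - (d - a) ^+ 2) / (4 * c).
  by rewrite -h; field; rewrite c0.
by rewrite /beta eb; field; rewrite ?c0 ?e0 ?T0 ?two0 ?four0.
Qed.

Lemma half_root (K : fieldType) (S x : K) : (2 : K) != 0 -> S ^+ 2 = - 3 * x ->
  ((1 + S) / 2) ^+ 2 = (1 + S) / 2 - (3 * x + 1) / 4.
Proof.
move=> two0 h.
have four0 : (4 : K) != 0 by rewrite (_ : 4 = 2 * 2) ?mulf_neq0//; ring.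
transitivity ((1 + 2 * S + S ^+ 2) / 4); first by field; rewrite ?two0 ?four0.
by rewrite h; field; rewrite ?two0 ?four0.
Qed.

(* With th = (1 + s / T) / 2, the root of X^2 = X + n, the ratio in the       *)
(* hypothesis is (x + y th) / (x + y (1 - th)), and the second coordinate of  *)
(* psix vanishes only if the sixth powers of these two conjugates agree.      *)
Lemma psix_neq0 (L : fieldType) (i : {rmorphism Q2 -> L}) (n T w k e : Q2) (s : L) z :
  T != 0 -> k != 0 -> s ^+ 2 = i (- 3 * w ^+ 2) ->
  n = - ((3 * (w / T) ^+ 2 + 1) / 4) ->
  2 * (k * z.1) = e - T -> k * z.2 = T -> i e - s != 0 ->
  ((i e + s) / (i e - s)) ^+ 6 != 1 -> (psix n z).2 != 0.
Proof.
move=> T0 k0 hs en kz1 kz2 A0; apply: contra_neq => y60.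
have i0 x : x != 0 -> i x != 0 by move=> x0; rewrite fmorph_eq0.
have two0 : (2 : L) != 0 by rewrite -(rmorph_nat i 2) i0// Q2_2neq0.
pose S := s / i T.
have hS : S ^+ 2 = - 3 * i ((w / T) ^+ 2).
  rewrite /S expr_div_n hs -rmorphXn -fmorph_div.
  have -> : - 3 * w ^+ 2 / T ^+ 2 = - 3 * (w / T) ^+ 2 by rewrite expr_div_n [RHS]mulrA.
  by rewrite rmorphM rmorphN rmorph_nat.
have in_ : i n = - ((3 * i ((w / T) ^+ 2) + 1) / 4).
  by rewrite en rmorphN fmorph_div rmorphD rmorphM !rmorph_nat rmorph1.
have root (S' : L) : S' ^+ 2 = - 3 * i ((w / T) ^+ 2) ->
    ((1 + S') / 2) ^+ 2 = (1 + S') / 2 + i n.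
  by move=> /(half_root two0) ->; rewrite in_.
have hS' : (- S) ^+ 2 = - 3 * i ((w / T) ^+ 2) by rewrite sqrrN.
have e1 := ev_psix z (root _ hS); have e2 := ev_psix z (root _ hS').
move: e1 e2; rewrite y60 rmorph0 !mul0r => -> e12.
have muE (S' : L) : 2 * i k * (i z.1 + i z.2 * ((1 + S') / 2)) = i e + i T * S'.
  transitivity (i (2 * (k * z.1)) + i (k * z.2) * (1 + S')).
    rewrite !rmorphM rmorph_nat; move: (i k) (i z.1) (i z.2) => x y y'.
    by rewrite -[X in _ = _ + _ * X](divfK two0); ring.
  by rewrite kz1 kz2 rmorphB; ring.
have STs : i T * S = s by rewrite mulrC /S divfK// i0.
have mu0 : 2 * i k != 0 by rewrite mulf_neq0// i0.
have := muE (- S); rewrite mulrN STs => EA'.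
have := muE S; rewrite STs => EA.
rewrite expr_div_n -EA exprMn e12 -exprMn EA' divff//.
by rewrite expf_neq0.
Qed.

(* L is a finite extension of Q_2 containing s = sqrt Delta and               *)
(* t = sqrt (-3).  As Q_2(sqrt Delta) / Q_2 is unramified, the real           *)
(* v2 absL s is an integer, so Num.floor only changes its type.               *)
Theorem theorem6p5 (R : realType) (mu0 : probability (borel Q2) R)
    (hmu0 : haar_probability_Z2 mu0)
    (a b c d : Q2) (had : a * d - b * c != 0)
    (L : fieldExtType Q2) (absL : L -> R) (habsL : extends_abs2 absL)
    (s : L) (hs : s ^+ 2 = ((d - a) ^+ 2 + 4 * b * c)%:A)
    (hsQ2 : s \notin 1%VS)
    (hlambda : forall n : nat, (0 < n)%N ->
      (((a + d)%:A + s) / ((a + d)%:A - s)) ^+ n != 1)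
    (t : L) (ht : t ^+ 2 = - 3)
    (hfield : <<1%VS; s>>%VS = <<1%VS; t>>%VS)
    (eta : Q2) (heta : ratr (abs2 eta) = absL (s / c%:A))
    (B : set P1) (hB : minimal_subsystem (mobius a b c d) B) :
  let h := affine eta ((a - d - 2 ^ Num.floor (v2 absL s)) / (2 * c)) in
  exists sigma : probability (borel P1) R,
    [/\ invariant_probability (mobius a b c d) B sigma,
        forall A : set (borel P1), measurable A -> A `<=` B ->
          sigma A = (mu_hat mu0 (h @^-1` A) / mu_hat mu0 (h @^-1` B))%E &
        forall tau : probability (borel P1) R,
          invariant_probability (mobius a b c d) B tau ->
          forall A : set (borel P1), measurable A -> A `<=` B ->
            tau A = sigma A].
Proof.
move=> h; have [abs_ge0 abs_eq0 absM _ absA] := habsL.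
(* If c = 0 then Delta is the square of d - a, and s would lie in Q_2. *)
have c0 : c != 0.
  apply: contraNneq hsQ2 => c0; move: hs; rewrite c0 mulr0 addr0 => hs'.
  have : (s - (d - a)%:A) * (s + (d - a)%:A) = 0.
    rewrite -subr_sqr hs' -[X in X - _]in_algE -[X in _ - X ^+ 2]in_algE.
    by rewrite rmorphXn subrr.
  move=> /eqP; rewrite mulf_eq0 subr_eq0 addr_eq0 => /orP[|] /eqP ->.
    exact: in_alg_mem1.
  by rewrite rpredN in_alg_mem1.
have ht' : t ^+ 2 = (- 3 : Q2)%:A.
  by rewrite ht -in_algE rmorphN rmorph_nat.
have [w [w0 es hD]] := adjoin_sqrt_mul Q2_2neq0 hs hsQ2 ht' hfield.
have [v wv] := abs2_val w0.
pose T : Q2 := 2 ^ v.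
have T0 : T != 0 by rewrite -abs2_eq0E -wv abs2_eq0E.
have abst : absL t = 1.
  have : absL t ^+ 2 = 1.
    by rewrite expr2 -absM -expr2 ht' absA abs2N abs2_nat rmorph1.
  by move=> /eqP; rewrite sqrf_eq1 => /orP[/eqP//|/eqP h1]; have := abs_ge0 t; rewrite h1 ler0N1.
have abss : absL s = ratr (abs2 w) by rewrite es absM absA abst mulr1.
have hfl : Num.floor (v2 absL s) = v.
  by apply: floor_v2; rewrite abss wv abs2_exp2.
rewrite /h hfl -/T; set beta := (a - d - T) / (2 * c); clear h.
have eta_c : abs2 (eta * c) = abs2 T.
  have : ratr (abs2 (eta * c)) = ratr (abs2 w) :> R.
    transitivity (absL (s / c%:A) * absL c%:A).
      by rewrite absA -heta -rmorphM -abs2M.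
    by rewrite -absM divfK ?abss// -in_algE fmorph_eq0.
  by rewrite -wv => /fmorph_inj.
have e0 : eta != 0.
  by apply: contraNneq T0 => h; rewrite -abs2_eq0E -eta_c h mul0r abs20.
pose n2 := c * eta / T.
pose n1 := (b + (a - d) * beta - c * beta ^+ 2) / (eta * T).
pose u := w / T.
have u1 : abs2 u = 1 by rewrite /u abs2M abs2V wv divff// abs2_eq0E.
have en : n1 * n2 = - ((3 * u ^+ 2 + 1) / 4).
  exact: (conj_norm Q2_2neq0 c0 e0 T0 hD).
have n21 : abs2 n2 = 1.
  by rewrite /n2 [c * _]mulrC abs2M eta_c abs2V divff// abs2_eq0E.
have n11 : abs2 n1 = 1.
  by rewrite -[LHS]mulr1 -n21 -abs2M en abs2N unit_square.
(* T D = c beta + d is the lower right entry of h^-1 M h, so this matrix is T (D + N); the pair (D,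
   1) is then rescaled to a primitive one. *)
pose D := (a + d - T) / (2 * T).
have [z [k [pz k0 kz1 kz2]]] : exists z k,
    [/\ primitive z, k != 0, k * z.1 = T * D & k * z.2 = T].
  have [D1|D1] := leP (abs2 D) 1.
    exists (D, 1), T; split=> //; last by rewrite mulr1.
    by apply/primitiveP; rewrite /= abs21; split=> //; right.
  have D0 : D != 0 by rewrite -abs2_gt0 (lt_trans _ D1).
  exists (1, D^-1), (T * D); split.
  - apply/primitiveP; rewrite /= abs21; split=> //; last by left.
    by rewrite abs2V invf_le1 ?abs2_gt0// ltW.
  - by rewrite mulf_neq0.
  - by rewrite mulr1.
  - by rewrite /= mulfK.
have cb : 2 * (c * beta) = a - d - T.
  by rewrite mulrA mulrC /beta divfK// mulf_neq0// Q2_2neq0.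
have TD : 2 * (T * D) = a + d - T.
  by rewrite mulrA mulrC /D divfK// mulf_neq0// Q2_2neq0.
have inj2 := mulfI Q2_2neq0.
have conj p : mobius a b c d (affine eta beta p) = affine eta beta (mobN n1 n2 z p).
  apply: (mobius_conj (k := k)) => //.
  - rewrite kz1; apply: inj2; rewrite TD mulrDr cb; ring.
  - by rewrite mulrA kz2 /n2 mulrC divfK.
  - rewrite mulrDr kz1 kz2; apply: inj2.
    by rewrite mulrDr TD [beta * c]mulrC mulrBr cb; ring.
  - by rewrite (mulrA k) kz2 mulrA mulrC /n1 divfK// mulf_neq0.
have psix0 : (psix (n1 * n2) z).2 != 0.
  apply: (@psix_neq0 L (in_alg L) _ T w k (a + d) s z T0 k0 _ en) => //.
  - by rewrite hs hD.
  - by rewrite kz1 TD.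
  - apply: contraNneq hsQ2 => /eqP; rewrite subr_eq0 => /eqP <-.
    exact: in_alg_mem1.
  - exact: hlambda 6 isT.
have [m dense] := mobN_dense n11 n21 pz psix0.
have [nu [nuoo nuE]] := @mu_hat_measure R mu0 eta beta e0.
have hi p : unaffine eta beta (mobius a b c d p) =
    mobN n1 n2 z (unaffine eta beta p).
  by rewrite -{1}[p](unaffineK beta e0) conj affineK.
have hiter j p : unaffine eta beta (iter j (mobius a b c d) p) =
    iter j (mobN n1 n2 z) (unaffine eta beta p).
  by elim: j => //= j IH; rewrite hi IH.
have [|||||sigma [s1 s2 s3]] := @minimal_subsystem_measure R eta beta
  (mobius a b c d) B nu (fun k => 2 / 3 * 2 ^- k.+1) e0 _ _ _ _ nuoo _ hB.
- by move=> j p q; rewrite /cell /= !hi rho_mobN.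
- by move=> q; exact: mobius_surjective.
- by move=> j p; rewrite nuE mu_hat_cell.
- by move=> j; rewrite mulr_gt0 ?divr_gt0// invr_gt0 exprn_gt0.
- exists m => p q j pq.
  have [i hi'] : exists i, rho (iter i (mobN n1 n2 z) (unaffine eta beta p))
      (unaffine eta beta q) <= 2 ^- j.+1.
    apply: dense; apply: le_trans pq _.
    by rewrite lef_pV2 ?posrE ?exprn_gt0// ler_eXn2l.
  by exists i; rewrite /cell /= hiter.
exists sigma; split=> // A mA AB.
by rewrite s2// !nuE.
Qed.
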